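(* Let $N\in\mathbb{N}$ and let $u\in\dot H^{\frac12}(\mathbb{R},\mathbb{S}^{N-1})$. Then $u$ is a solution to \[ (-\Delta)^{\frac12}u^i = u^i\,|d_{\frac12}u|_2^2\quad\text{in }\mathbb{R},\ \text{for } i=1,\ldots,N, \] if and only if \[ \Omega_{ik}(x,y):=u^i(x)\,d_{\frac12}u^k(x,y)-u^k(x)\,d_{\frac12}u^i(x,y) \] satisfies \[ \operatorname{div}_{\frac12}\Omega_{ik}=0\quad\text{for all } i,k\in\{1,\ldots,N\}. \]
   Context: $\mathbb{S}^{N-1}\subset\mathbb{R}^N$ is the unit sphere. $\dot H^{\frac12}(\mathbb{R},\mathbb{S}^{N-1})$ is the set of measurable maps $u=(u^1,\dots,u^N):\mathbb{R}\to\mathbb{R}^N$ with $\int_{\mathbb{R}}\int_{\mathbb{R}}\frac{|u(x)-u(y)|^2}{|x-y|^2}dx\,dy<\infty$ and $u(x)\in\mathbb{S}^{N-1}$ for a.e. $x\in\mathbb{R}$. For a function $f$ on $\mathbb{R}$, $d_{\frac12}f(x,y):=\frac{f(x)-f(y)}{|x-y|^{1/2}}$, and $|d_{\frac12}u|_2^2(x):=\sum_{k=1}^N\int_{\mathbb{R}}|d_{\frac12}u^k(x,y)|^2\frac{dy}{|x-y|}$. The half-Laplacian is normalized by $\int_{\mathbb{R}}(-\Delta)^{\frac12}f\,h\,dx=\int_{\mathbb{R}}\int_{\mathbb{R}}d_{\frac12}f(x,y)\,d_{\frac12}h(x,y)\frac{dx\,dy}{|x-y|}$, and the equation is understood in the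 distributional sense: for all $\varphi\in C_c^\infty(\mathbb{R})$ and all $i$, $\int_{\mathbb{R}}\int_{\mathbb{R}}d_{\frac12}u^i\,d_{\frac12}\varphi\,\frac{dx\,dy}{|x-y|}=\int_{\mathbb{R}}u^i\,|d_{\frac12}u|_2^2\,\varphi\,dx$. For a measurable $F:\mathbb{R}\times\mathbb{R}\to\mathbb{R}$, $\operatorname{div}_{\frac12}F=0$ means $\int_{\mathbb{R}}\int_{\mathbb{R}}F(x,y)\,d_{\frac12}\varphi(x,y)\,\frac{dx\,dy}{|x-y|}=0$ for all $\varphi\in C_c^\infty(\mathbb{R})$. *)

(* Defs.v *)
From HB Require Import structures.
From mathcomp Require Import all_boot all_order all_algebra.
From mathcomp Require Import all_classical all_reals all_analysis.
Import Order.TTheory GRing.Theory Num.Theory.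
Import numFieldNormedType.Exports.

Set Implicit Arguments.
Unset Strict Implicit.
Unset Printing Implicit Defensive.

Local Open Scope classical_set_scope.
Local Open Scope ring_scope.

(* The real line with its Lebesgue (not just Borel) sigma-algebra, so that
   "measurable" and "almost everywhere" have their usual meaning. *)
Notation lebR R := (caratheodory_type ((@wlength R idfun)^*)%mu).
Notation leb R := (@completed_lebesgue_measure R).
Notation leb2 R := (leb R \x leb R)%E.

Section half_laplacian.
Context {R : realType}.
Implicit Types (f phi : R -> R) (F : R -> R -> R).

(* The library norm on 'rV[R]_N is the sup norm; this is the Euclidean one. *)
Definition enorm N (v : 'rV[R]_N) : R := Num.sqrt (\sum_(k < N) v ord0 k ^+ 2).

Definition sphere N : set 'rV[R]_N := [set v | enorm v = 1].

Definition ucomp N (u : R -> 'rV[R]_N) (k : 'I_N) : R -> R := fun x => u x ord0 k.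

(* On the diagonal x = y, a null set of the plane, the quotients below are 0. *)
Definition d12 f : R -> R -> R := fun x y => (f x - f y) / Num.sqrt `|x - y|.

(* Integral over the plane of F(x,y) G(x,y) dx dy / |x - y|, in \bar R. *)
Definition pair12 F (G : R -> R -> R) : \bar R :=
  (\int[leb2 R]_z (F z.1 z.2 * G z.1 z.2 / `|(z.1 : R) - z.2|)%:E)%E.

Definition sq_d12 N (u : R -> 'rV[R]_N) (x : R) : \bar R :=
  (\sum_(k < N)
     \int[leb R]_y ((`|d12 (ucomp u k) x y| ^+ 2 / `|x - (y : R)|)%:E))%E.

Definition Hdot12 N (u : R -> 'rV[R]_N) : Prop :=
  [/\ forall k, measurable_fun [set: lebR R] (ucomp u k),
      (\int[leb2 R]_z
         (enorm (u z.1 - u z.2) ^+ 2 / `|(z.1 : R) - z.2| ^+ 2)%:E < +oo)%E &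
      {ae leb R, forall x, sphere (u x)}].

Definition test_function phi : Prop :=
  (forall (n : nat) (x : R), derivable (derive1n n phi) x 1) /\
  compact (closure [set x | phi x != 0]).

Definition half_harmonic_eq N (u : R -> 'rV[R]_N) (i : 'I_N) : Prop :=
  forall phi, test_function phi ->
    pair12 (d12 (ucomp u i)) (d12 phi) =
    (\int[leb R]_x ((ucomp u i x)%:E * sq_d12 u x * (phi x)%:E))%E.

Definition div12_eq0 F : Prop :=
  forall phi, test_function phi -> pair12 F (d12 phi) = 0%E.

Definition Omega N (u : R -> 'rV[R]_N) (i k : 'I_N) : R -> R -> R :=
  fun x y => ucomp u i x * d12 (ucomp u k) x y - ucomp u k x * d12 (ucomp u i) x y.

End half_laplacian.

(* Main.v *)
(* With D f (x, y) = (f x - f y) / |x - y|, the form of the half-Laplacian is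
   the integral of D f * D g over the plane.  The Leibniz rule gives pointwise
     D(u^k) D(u^i phi) - D(u^i) D(u^k phi) = Omega_ik D(phi)
   and, since |u| = 1,
     sum_k Omega_ik D(u^k phi)
       = |D u|^2 ((u^i phi)(x) + (u^i phi)(y)) / 2 - D(u^i) D(phi).
   So the equation tested with u^k phi gives the divergence condition, and the
   divergence condition tested with u^k phi and summed over k gives the equation.
   The functions u^k phi are only bounded, compactly supported and of finite
   energy: both weak equations extend to such v by mollification.  By Jensen
   mollifying does not increase the energy, and by Lebesgue differentiation
   it converges almost everywhere; boundedness in L^2 plus almost everywhere
   convergence imply weak convergence in L^2.

   Translation arguments need joint measurability, so u is first replaced by a
   Borel representative with values on the sphere everywhere. *)
Require Import Defs.
From HB Require Import structures.
From mathcomp Require Import all_boot all_order all_algebra.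
From mathcomp Require Import all_classical all_reals all_analysis.
From mathcomp Require Import measurable_realfun ring lra.
Import Order.TTheory GRing.Theory Num.Theory.
Import numFieldNormedType.Exports.

Set Implicit Arguments.
Unset Strict Implicit.
Unset Printing Implicit Defensive.

Local Open Scope classical_set_scope.
Local Open Scope ring_scope.

(** The sphere enters through sum_k u^k(x) u^k(y) = 1 - |u(x) - u(y)|^2 / 2, valid when |u(x)| =
    |u(y)| = 1: it turns the mixed products in sum_k Omega_ik D(u^k phi) into |D u|^2. The two
    halves at x and at y then have equal integrals, because |D u|^2 is symmetric and the plane
    measure is invariant under the swap of x and y; together they form the right-hand side of the
    equation. Weak convergence suffices for the extension to u^k phi because the approximating
    D(v_n) is always paired with one fixed function of L^2, either D(u^i) or Omega_ik, while the
    other side is the integral of v_n against a fixed function of L^1. Integrals take values in the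
    extended reals, where the integral of a sum or difference of signed functions is split under
    integrability; hence products are placed in L^1 before an identity is integrated. *)

(** * Square-integrable functions and weak convergence in L^2 *)

Section square_integrable.
Context d (T : measurableType d) (R : realType) (mu : {measure set T -> \bar R}).
Implicit Types f g : T -> R.

Definition square_integrable f :=
  measurable_fun setT f /\ (\int[mu]_x (f x ^+ 2)%:E < +oo)%E.

Lemma ge0_integrable f : measurable_fun setT f -> (forall x, 0 <= f x) ->
  (\int[mu]_x (f x)%:E < +oo)%E -> mu.-integrable setT (EFin \o f).
Proof.
move=> mf f0 foo; apply/integrableP; split; first exact/measurable_EFinP.
by under eq_integral do rewrite /= ger0_norm//.
Qed.

Lemma integrable_dominated f g : measurable_fun setT f ->
  (forall x, `|f x| <= g x) -> mu.-integrable setT (EFin \o g) ->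
  mu.-integrable setT (EFin \o f).
Proof.
move=> mf fg; apply: le_integrable => //; first exact/measurable_EFinP.
by move=> x _ /=; rewrite lee_fin (le_trans (fg x))// ler_norm.
Qed.

Lemma square_integrable_sqr f : square_integrable f ->
  mu.-integrable setT (EFin \o (fun x => f x ^+ 2)).
Proof.
move=> [mf fi]; apply: ge0_integrable => //; last by move=> x; exact: sqr_ge0.
exact: measurable_funX.
Qed.

Lemma square_integrable_le f g : measurable_fun setT f ->
  (forall x, f x ^+ 2 <= g x) -> mu.-integrable setT (EFin \o g) ->
  square_integrable f.
Proof.
move=> mf fg gi; split=> //; have [mg goo] := integrableP _ _ _ gi.
apply: le_lt_trans goo; apply: ge0_le_integral => //.
- by move=> x _; rewrite lee_fin sqr_ge0.
- exact/measurable_EFinP/measurable_funX.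
- exact: measurableT_comp.
- by move=> x _; rewrite lee_fin (le_trans (fg x))// ler_norm.
Qed.

Lemma square_integrableM f g : square_integrable f -> square_integrable g ->
  mu.-integrable setT (EFin \o (fun x => f x * g x)).
Proof.
move=> [mf fi] [mg gi].
apply: (@integrable_dominated _ (fun x => f x ^+ 2 + g x ^+ 2)).
- exact: measurable_funM.
- move=> x; rewrite normrM -(real_normK (num_real (f x))).
  rewrite -(real_normK (num_real (g x))).
  have := sqr_ge0 (`|f x| - `|g x|).
  have : 0 <= `|f x| * `|g x| by rewrite mulr_ge0.
  by move: `|f x| `|g x| => a b; nra.
- have := integrableD measurableT (square_integrable_sqr (conj mf fi))
    (square_integrable_sqr (conj mg gi)).
  by apply: eq_integrable.
Qed.

Lemma square_integrableB f g : square_integrable f -> square_integrable g ->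
  square_integrable (fun x => f x - g x).
Proof.
move=> fi gi.
apply: (@square_integrable_le _ (fun x => 2 * f x ^+ 2 + 2 * g x ^+ 2)).
- by apply: measurable_funB; [case: fi|case: gi].
- by move=> x; have := sqr_ge0 (f x + g x); move: (f x) (g x) => a b; nra.
- have := integrableD measurableT
    (integrableZl measurableT 2 (square_integrable_sqr fi))
    (integrableZl measurableT 2 (square_integrable_sqr gi)).
  by apply: eq_integrable.
Qed.

Lemma square_integrable_bounded f g (C : R) : measurable_fun setT f ->
  (forall x, `|f x| <= C) -> square_integrable g ->
  square_integrable (fun x => f x * g x).
Proof.
move=> mf fC gi.
apply: (@square_integrable_le _ (fun x => C ^+ 2 * g x ^+ 2)).
- by apply: measurable_funM => //; case: gi.
- move=> x; rewrite exprMn ler_wpM2r ?sqr_ge0//.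
  rewrite -(real_normK (num_real (f x))) lerXn2r ?nnegrE//.
  exact: le_trans (fC x).
- have := integrableZl measurableT (C ^+ 2) (square_integrable_sqr gi).
  by apply: eq_integrable.
Qed.

(* On [|H n - H| <= lambda |G|] dominated convergence applies, with dominating
   function [lambda G ^ 2]; elsewhere [|G| |H n - H| <= |H n - H| ^ 2 / lambda]. *)
Lemma bounded_ae_cvg_weak (G H : T -> R) (Hn : nat -> T -> R) (M : R) :
  square_integrable G -> measurable_fun setT H ->
  (forall n, measurable_fun setT (Hn n)) ->
  (\int[mu]_x (H x ^+ 2)%:E <= M%:E)%E ->
  (forall n, \int[mu]_x (Hn n x ^+ 2)%:E <= M%:E)%E ->
  {ae mu, forall x, Hn ^~ x @ \oo --> H x} ->
  (\int[mu]_x (G x * Hn n x)%:E)%E @[n --> \oo] -->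
  (\int[mu]_x (G x * H x)%:E)%E.
Proof.
move=> Gi mH mHn HM HnM cvgH.
have mG : measurable_fun setT G by case: Gi.
have Hi : square_integrable H by split=> //; exact: le_lt_trans HM (ltry _).
have Hni n : square_integrable (Hn n).
  by split=> //; exact: le_lt_trans (HnM n) (ltry _).
have M0 : 0 <= M.
  by rewrite -lee_fin (le_trans _ HM)// integral_ge0// => x _; rewrite lee_fin sqr_ge0.
have GHi := square_integrableM Gi Hi.
have GHni n := square_integrableM Gi (Hni n).
pose D n x := Hn n x - H x.
have Di n : square_integrable (D n) by exact: square_integrableB.
have mD n : measurable_fun setT (D n) by case: (Di n).
(* The factor 4 comes from (a - b)^2 <= 2 a^2 + 2 b^2. *)
have DM n : (\int[mu]_x (D n x ^+ 2)%:E <= (4 * M)%:E)%E.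
  apply: (@le_trans _ _ (\int[mu]_x (2%:E * (Hn n x ^+ 2)%:E + 2%:E * (H x ^+ 2)%:E))%E).
    apply: ge0_le_integral => //.
    - by move=> x _; rewrite lee_fin sqr_ge0.
    - exact/measurable_EFinP/measurable_funX.
    - by apply/measurable_EFinP; apply: measurable_funD; apply: measurable_funM => //;
        exact: measurable_funX.
    - move=> x _; rewrite lee_fin /D.
      by have := sqr_ge0 (Hn n x + H x); move: (Hn n x) (H x) => a b; nra.
  rewrite ge0_integralD//.
  - rewrite !ge0_integralZl_EFin//.
    + have -> : ((4 * M)%:E = 2%:E * M%:E + 2%:E * M%:E)%E.
        by rewrite -!EFinM -EFinD; congr EFin; ring.
      by apply: leeD; apply: lee_pmul => //; apply: integral_ge0 => x _;
        rewrite lee_fin sqr_ge0.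
    + by move=> x _; rewrite lee_fin sqr_ge0.
    + exact/measurable_EFinP/measurable_funX.
    + by move=> x _; rewrite lee_fin sqr_ge0.
    + exact/measurable_EFinP/measurable_funX.
  - by move=> x _; rewrite -EFinM lee_fin mulr_ge0// sqr_ge0.
  - by apply/measurable_EFinP; apply: measurable_funM => //; exact: measurable_funX.
  - by move=> x _; rewrite -EFinM lee_fin mulr_ge0// sqr_ge0.
  - by apply/measurable_EFinP; apply: measurable_funM => //; exact: measurable_funX.
pose K (l : R) n x := Num.min (`|G x| * `|D n x|) (l * G x ^+ 2).
have mK l n : measurable_fun setT (K l n).
  apply: measurable_minr.
    by apply: measurable_funM; exact: measurableT_comp.
  by apply: measurable_funM => //; exact: measurable_funX.
have K0 (l : R) n x : 0 <= l -> 0 <= K l n x.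
  move=> l0; rewrite /K le_min mulr_ge0//=.
  by rewrite mulr_ge0// sqr_ge0.
have K_cvg (l : R) : 0 <= l -> (\int[mu]_x (K l n x)%:E)%E @[n --> \oo] --> 0%E.
  move=> l0.
  have Gl : mu.-integrable setT (fun x => (l * G x ^+ 2)%:E).
    have := integrableZl measurableT l (square_integrable_sqr Gi).
    by apply: eq_integrable.
  have := @dominated_convergence _ _ _ mu setT measurableT
    (fun n x => (K l n x)%:E) (cst 0%E) (fun x => (l * G x ^+ 2)%:E) _ _ _ Gl.
  rewrite integral0 => Kcvg; apply Kcvg => //.
  - by move=> n; exact/measurable_EFinP.
  - apply: filterS cvgH => x Hx _ /=; apply: cvg_EFin; first exact: nearW.
    apply: (@squeeze_cvgr _ _ _ _ (cst 0) (fun n => `|G x| * `|D n x|)).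
    + by near=> n; rewrite K0//= /K ge_min lexx.
    + exact: cvg_cst.
    + rewrite -(mulr0 `|G x|); apply: cvgM; first exact: cvg_cst.
      have D0 : D n x @[n --> \oo] --> 0.
        by rewrite -(subrr (H x)); apply: cvgB => //; exact: cvg_cst.
      by have := cvg_norm D0; rewrite normr0; apply.
  - apply/aeW => x n _ /=; rewrite lee_fin ger0_norm ?K0// /K ge_min lexx orbT//.
have DK n (l : R) : 0 < l ->
    (`|\int[mu]_x (G x * Hn n x)%:E - \int[mu]_x (G x * H x)%:E| <=
     \int[mu]_x (K l n x)%:E + (4 * M / l)%:E)%E.
  move=> l0; rewrite -integralB//; last exact: GHni.
  have iGD : mu.-integrable setT (EFin \o (fun x => G x * D n x)).
    exact: square_integrableM.
  rewrite (_ : (fun _ => _) = EFin \o (fun x => G x * D n x)); last first.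
    by apply/funext => x /=; rewrite -EFinB /D mulrBr.
  apply: (le_trans (le_abse_integral _ _ _)) => //.
    by case/integrableP : iGD.
  apply: (@le_trans _ _ (\int[mu]_x ((K l n x)%:E + (l^-1)%:E * (D n x ^+ 2)%:E))%E).
    apply: ge0_le_integral => //.
    - by apply: measurableT_comp => //; case/integrableP : iGD.
    - by apply/measurable_EFinP; apply: measurable_funD => //; apply: measurable_funM => //;
        exact: measurable_funX.
    - move=> x _; rewrite /= lee_fin normrM /K -(real_normK (num_real (G x))).
      rewrite -(real_normK (num_real (D n x))).
      have [dg|gd] := leP `|D n x| (l * `|G x|).
        rewrite (min_idPl _).
          by rewrite ler_wpDr// mulr_ge0 ?invr_ge0 ?sqr_ge0// ltW.
        by rewrite expr2 mulrCA ler_wpM2l.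
      rewrite ler_wpDl//.
        by rewrite le_min mulr_ge0//= mulr_ge0 ?sqr_ge0// ltW.
      by rewrite (expr2 `|D n x|) mulrA ler_wpM2r// mulrC ler_pdivlMr// mulrC ltW.
  rewrite ge0_integralD//; last 4 first.
  - by move=> x _; rewrite lee_fin K0// ltW.
  - exact/measurable_EFinP.
  - by move=> x _; rewrite -EFinM lee_fin mulr_ge0 ?sqr_ge0// invr_ge0 ltW.
  - by apply/measurable_EFinP; apply: measurable_funM => //; exact: measurable_funX.
  rewrite leeD2l// ge0_integralZl_EFin//; last 3 first.
  - by move=> x _; rewrite lee_fin sqr_ge0.
  - exact/measurable_EFinP/measurable_funX.
  - by rewrite invr_ge0 ltW.
  by rewrite (mulrC _ l^-1) EFinM lee_wpmul2l// lee_fin invr_ge0 ltW.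
have fGH := integrable_fin_num measurableT GHi.
have fGHn n := integrable_fin_num measurableT (GHni n).
rewrite -[X in _ --> X](fineK fGH); apply/fine_cvgP; split; first exact/nearW/fGHn.
apply/cvgrPdist_le => e e0.
(* The term [8 * M / e] makes the error [4 * M / l] at most e / 2; the [+ 1] keeps [l] positive when
   [M] is 0. *)
pose l := 8 * M / e + 1.
have l0 : 0 < l by rewrite ltr_wpDl// divr_ge0 ?mulr_ge0// ltW.
have Mle : 4 * M / l <= e / 2.
  rewrite ler_pdivrMr// /l mulrDr mulr1.
  have -> : e / 2 * (8 * M / e) = 4 * M by field; rewrite gt_eqF.
  by rewrite lerDl divr_ge0// ltW.
have /fine_cvgP[Kfin /cvgrPdist_le/(_ (e / 2))] := K_cvg l (ltW l0).
rewrite divr_gt0// => /(_ isT) Ke.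
near=> n.
have := DK n l l0.
have Kn : (\int[mu]_x (K l n x)%:E)%E \is a fin_num by near: n.
rewrite -[X in (`|X - _|)%E](fineK (fGHn n)) -[X in (`|_ - X|)%E](fineK fGH).
rewrite -(fineK Kn) -EFinB -EFinD lee_fin distrC => /le_trans; apply.
rewrite (splitr e) lerD//.
have : `|0 - fine (\int[mu]_x (K l n x)%:E)%E| <= e / 2 by near: n.
by rewrite sub0r normrN; apply: le_trans; exact: ler_norm.
Unshelve. all: end_near. Qed.

End square_integrable.

(** * Changes of variables on the line and in the plane, and Tonelli's theorem *)

Section measure_preserving.
Local Open Scope ereal_scope.
Context d1 d2 (X : measurableType d1) (Y : measurableType d2) (R : realType).
Variables (m1 : {measure set X -> \bar R}) (m2 : {measure set Y -> \bar R}).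
Variables (phi : X -> Y) (mphi : measurable_fun setT phi).
Hypothesis phiE : forall A, measurable A -> m1 (phi @^-1` A) = m2 A.

(** Positive and negative parts are treated separately as nonnegative functions, so [f] may be any
    measurable function, integrable or not. *)
Lemma integral_measure_preserving (f : Y -> \bar R) : measurable_fun setT f ->
  \int[m1]_x f (phi x) = \int[m2]_y f y.
Proof.
move=> mf.
have ge0 (g : Y -> \bar R) : measurable_fun setT g -> (forall y, 0 <= g y) ->
    \int[m1]_x g (phi x) = \int[m2]_y g y.
  move=> mg g0; transitivity (\int[pushforward m1 phi]_y g y).
    by rewrite ge0_integral_pushforward// preimage_setT.
  by apply: eq_measure_integral => A mA _; rewrite -phiE.
rewrite integralE [RHS]integralE; congr (_ - _).
- by under eq_integral do rewrite funepos_comp; rewrite ge0//; exact: measurable_funepos.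
- by under eq_integral do rewrite funeneg_comp; rewrite ge0//; exact: measurable_funeneg.
Qed.

End measure_preserving.

Section translation.
Context (R : realType).
Notation mu := (@lebesgue_measure R).

(** Lebesgue measure is determined by its values on the intervals []a, b]], and translation keeps
    their length. *)
Lemma lebesgue_measure_shift (t : R) (A : set R) : measurable A ->
  mu ((fun x => x + t) @^-1` A) = mu A.
Proof.
move=> mA.
have mf : measurable_fun setT ((fun x => x + t) : measurableTypeR R -> measurableTypeR R).
  exact: measurable_funD.
pose f_mfun := isMeasurableFun.Build _ _ _ _ _ mf.
pose f : {mfun measurableTypeR R >-> measurableTypeR R} :=
  HB.pack (fun x : R => x + t) f_mfun.
apply/esym/(@lebesgue_measure_unique R (pushforward mu f)) => // _ [[a b]] _ <-.
rewrite [RHS](_ : _ = mu `]a - t, b - t]%classic); last first.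
  congr (mu _); apply/seteqP.
  by split=> x /=; rewrite !in_itv/= ltrBlDr lerBrDr.
rewrite !lebesgue_measure_itv/= !lte_fin ltrD2r.
by case: ifP => // _; rewrite -!EFinB; congr EFin; ring.
Qed.

Lemma integral_shift (t : R) (f : R -> \bar R) : measurable_fun setT f ->
  (\int[mu]_x f (x + t)%R)%E = (\int[mu]_x f x)%E.
Proof.
move=> mf; apply: (@integral_measure_preserving _ _ _ _ _ mu mu (fun x => x + t)) => //.
- exact: measurable_funD.
- exact: lebesgue_measure_shift.
Qed.

End translation.

Section product_measure_preserving.
Context d1 d2 d3 d4 (X1 : measurableType d1) (X2 : measurableType d2)
  (Y1 : measurableType d3) (Y2 : measurableType d4) (R : realType).
Variables (m1 : {sigma_finite_measure set X1 -> \bar R})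
  (m2 : {sigma_finite_measure set X2 -> \bar R})
  (n1 : {sigma_finite_measure set Y1 -> \bar R})
  (n2 : {sigma_finite_measure set Y2 -> \bar R}).

(** Rectangles determine a product of sigma-finite measures, so it is enough to measure their
    preimages. Applied to the diagonal translation, to the swap, and to the identity from the
    Lebesgue to the Borel structure of the plane. *)
Lemma product_measure_preserving (phi : X1 * X2 -> Y1 * Y2) :
  measurable_fun setT phi ->
  (forall A B, measurable A -> measurable B ->
    (m1 \x m2)%E (phi @^-1` (A `*` B)) = (n1 A * n2 B)%E) ->
  forall A, measurable A -> (m1 \x m2)%E (phi @^-1` A) = (n1 \x n2)%E A.
Proof.
move=> mphi phiE A mA.
pose phi_mfun := isMeasurableFun.Build _ _ _ _ _ mphi.
pose f : {mfun (X1 * X2)%type >-> (Y1 * Y2)%type} := HB.pack phi phi_mfun.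
by apply/esym/(@product_measure_unique _ _ _ _ _ n1 n2 (pushforward (m1 \x m2)%E f)).
Qed.

End product_measure_preserving.

Section plane.
Context (R : realType).
Notation mu := (@lebesgue_measure R).
Notation mu2 := (mu \x mu)%E.

Lemma integral_diagonal_shift (t : R) (f : R * R -> \bar R) :
  measurable_fun setT f ->
  (\int[mu2]_z f (z.1 + t, z.2 + t)%R)%E = (\int[mu2]_z f z)%E.
Proof.
move=> mf.
have mphi : measurable_fun setT (fun z : R * R => (z.1 + t, z.2 + t)).
  by apply/measurable_fun_pairP; split; apply: measurable_funD.
apply: (@integral_measure_preserving _ _ _ _ R mu2 mu2 _ mphi _ f mf).
apply: product_measure_preserving => // A B mA mB.
rewrite (_ : _ @^-1` _ = ((fun x => x + t) @^-1` A) `*` ((fun x => x + t) @^-1` B))//.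
have mp C : measurable C -> measurable ((fun x : R => x + t) @^-1` C).
  by move=> mC; rewrite -[_ @^-1` _]setTI; exact: measurable_funD.
rewrite product_measure1E; [|exact: mp..].
by congr (_ * _)%E; exact: lebesgue_measure_shift.
Qed.

Lemma integral_swap (f : R * R -> \bar R) : measurable_fun setT f ->
  (\int[mu2]_z f (z.2, z.1))%E = (\int[mu2]_z f z)%E.
Proof.
move=> mf.
have mphi : measurable_fun setT (fun z : R * R => (z.2, z.1)).
  by apply/measurable_fun_pairP; split; [exact: measurable_snd|exact: measurable_fst].
apply: (@integral_measure_preserving _ _ _ _ R mu2 mu2 _ mphi _ f mf).
apply: product_measure_preserving => // A B mA mB.
rewrite (_ : _ @^-1` _ = B `*` A); last by apply/seteqP; split=> z [].
by rewrite product_measure1E// muleC.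
Qed.

End plane.

Section product_sigma_finite.
Context d1 d2 d3 (T1 : measurableType d1) (T2 : measurableType d2)
  (T3 : measurableType d3) (R : realType).
Variables (m1 : {sigma_finite_measure set T1 -> \bar R})
  (m2 : {sigma_finite_measure set T2 -> \bar R})
  (m3 : {sigma_finite_measure set T3 -> \bar R}).

Lemma sigma_finite_product : sigma_finite setT (m1 \x m2)%E.
Proof.
have /sigma_finiteP[F [TF ndF Foo]] := sigma_finiteT m1.
have /sigma_finiteP[G [TG ndG Goo]] := sigma_finiteT m2.
exists (fun n => F n `*` G n).
  apply/seteqP; split => // -[x y] _.
  have [n _ Fnx] : (\bigcup_n F n) x by rewrite -TF.
  have [k _ Gky] : (\bigcup_n G n) y by rewrite -TG.
  exists (maxn n k) => //; split.
  - by move: x Fnx; exact/subsetPset/ndF/leq_maxl.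
  - by move: y Gky; exact/subsetPset/ndG/leq_maxr.
move=> k; have [mF Fk] := Foo k; have [mG Gk] := Goo k.
split; first exact: measurableX.
by rewrite product_measure1E// lte_mul_pinfty// ge0_fin_numE.
Qed.

(* The canonical sigma-finite structure on [m1 \x m2] found by unification is the
   one for subprobabilities, so the general one is packed by hand. *)
Lemma tonelli_product (f : (T1 * T2) * T3 -> \bar R) : measurable_fun setT f ->
  (forall w, 0 <= f w)%E ->
  (\int[(m1 \x m2)%E]_z \int[m3]_t f (z, t) =
   \int[m3]_t \int[(m1 \x m2)%E]_z f (z, t))%E.
Proof.
move=> mf f0.
pose m12_mixin := Measure_isSigmaFinite.Build _ _ _ (m1 \x m2)%E sigma_finite_product.
pose m12 : {sigma_finite_measure set (T1 * T2)%type -> \bar R} :=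
  HB.pack (m1 \x m2)%E m12_mixin.
exact: (@fubini_tonelli _ _ _ _ _ m12 m3 f mf f0).
Qed.

End product_sigma_finite.

(** * Smooth functions and a compactly supported bump *)

Section smooth.
Context (R : realType).
Implicit Types (f g : R -> R) (p : {poly R}).

Lemma is_derive_derive1 f g : (forall x : R, is_derive x (1 : R) f (g x)) -> (derive1 f) = g.
Proof. by move=> fg; apply/funext => x; rewrite derive1E derive_val. Qed.

(** Means n times differentiable: [smoothn 0] is vacuous and [smoothn 1] is differentiability. The
    finite order turns closure under sums, products and mollification into an induction on [n]. *)
Definition smoothn n f :=
  forall k, (k < n)%N -> forall x : R, derivable (derive1n k f) x 1.

Lemma smoothn0 f : smoothn 0 f.
Proof. by move=> k; rewrite ltn0. Qed.

Lemma smoothnS n f g : (forall x : R, is_derive x (1 : R) f (g x)) -> smoothn n g ->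
  smoothn n.+1 f.
Proof.
move=> fg gn [_ x|k]; first by case: (fg x).
by rewrite ltnS => kn x; rewrite derive1Sn (is_derive_derive1 fg); exact: gn.
Qed.

Lemma smoothn_is_derive n f : smoothn n.+1 f ->
  forall x : R, is_derive x (1 : R) f ((derive1 f) x).
Proof. by move=> fn x; rewrite derive1E; apply: DeriveDef => //; exact: fn 0%N _ x. Qed.

Lemma smoothn_derive n f : smoothn n.+1 f -> smoothn n (derive1 f).
Proof. by move=> fn k kn x; rewrite -derive1Sn; exact: fn. Qed.

Lemma smoothn_pred n f : smoothn n.+1 f -> smoothn n f.
Proof. by move=> fn k kn; apply: fn; rewrite ltnS ltnW. Qed.

Lemma smoothnD n f g : smoothn n f -> smoothn n g -> smoothn n (fun x => f x + g x).
Proof.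
elim: n f g => [|n IH] f g fn gn; first exact: smoothn0.
apply: (@smoothnS _ _ (fun x => (derive1 f) x + (derive1 g) x)).
  by move=> x; have := is_deriveD (smoothn_is_derive fn x) (smoothn_is_derive gn x).
by apply: IH; exact: smoothn_derive.
Qed.

Lemma smoothnM n f g : smoothn n f -> smoothn n g -> smoothn n (fun x => f x * g x).
Proof.
elim: n f g => [|n IH] f g fn gn; first exact: smoothn0.
apply: (@smoothnS _ _ (fun x => f x * (derive1 g) x + g x * (derive1 f) x)).
  by move=> x; have := is_deriveM (smoothn_is_derive fn x) (smoothn_is_derive gn x).
apply: smoothnD.
  by apply: IH; [exact: smoothn_pred|exact: smoothn_derive].
by apply: IH; [exact: smoothn_pred|exact: smoothn_derive].
Qed.

Lemma smoothn_cst n (c : R) : smoothn n (fun=> c).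
Proof.
elim: n c => [|n IH] c; first exact: smoothn0.
apply: (@smoothnS _ _ (fun=> 0)); exact: IH.
Qed.

Lemma smoothn_affine n (a b : R) f : smoothn n f -> smoothn n (fun x => f (a * x + b)).
Proof.
elim: n f => [|n IH] f fn; first exact: smoothn0.
apply: (@smoothnS _ _ (fun x => (derive1 f) (a * x + b) * a)).
  move=> x.
  have d1 : is_derive x (1 : R) (fun x => a * x + b) a.
    apply: is_derive_eq; rewrite /GRing.scale/=; ring.
  have := @is_derive1_comp R f (fun x => a * x + b) x _ _ (smoothn_is_derive fn _) d1.
  by [].
by apply: smoothnM; [apply: IH; exact: smoothn_derive|exact: smoothn_cst].
Qed.

(** Each monomial satisfies y^k <= k! e^y. With y = 1/x this controls p(1/x) e^(-1/x) as x decreases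
    to 0. *)
Lemma horner_le_expR p : exists C : R, forall y, 0 <= y -> `|p.[y]| <= C * expR y.
Proof.
exists (\sum_(i < size p) `|p`_i| * (i`!)%:R) => y y0.
rewrite horner_coef (le_trans (ler_norm_sum _ _ _))// mulr_suml ler_sum// => i _.
rewrite normrM -mulrA ler_wpM2l// normrX ger0_norm//.
case: (nat_of_ord i) => [|k].
  by rewrite expr0 fact0 mul1r -expR0 ler_expR.
rewrite -ler_pdivrMl ?ltr0n ?fact_gt0// mulrC.
by rewrite (le_trans _ (expR_ge1Dxn k y0))// lerDr.
Qed.

(* This family is closed under differentiation, hence consists of smooth functions. *)
Definition flat_exp p (x : R) := if 0 < x then p.[x^-1] * expR (- x^-1) else 0.

(** With y = 1/x, the derivative of p(y) e^(-y) in x is y^2 (p(y) - p'(y)) e^(-y), which gives the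
    polynomial [q]. At 0, the exponential bound applied to y^2 p(y) yields |[flat_exp p x]| <= |C|
    x^2, so the derivative there is 0. *)
Lemma is_derive_flat_exp p x :
  is_derive x (1 : R) (flat_exp p) (flat_exp ('X^2 * (p - p^`())%R) x).
Proof.
set q := 'X^2 * (p - p^`())%R.
have [x0|x0|->] := ltrgtP x 0.
- apply: (@near_eq_is_derive _ _ _ (cst 0)).
    near=> y; rewrite /flat_exp/= ltNge ltW//; near: y.
    exact: lt_nbhsl.
  by rewrite /flat_exp ltNge ltW//=; exact: is_derive_cst.
- have dV : is_derive x (1 : R) (fun y : R => y^-1) (- x ^- 2).
    have xn0 : x != 0 by rewrite gt_eqF.
    apply: DeriveDef; first exact: derivableV.
    by rewrite deriveV// derive_id scaler1.
  have dp := @is_derive1_comp R (horner p) (fun y => y^-1) x _ _ (is_derive_poly p _) dV.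
  have dN : is_derive x (1 : R) (fun y : R => - y^-1) (x ^- 2).
    by have := is_deriveN dV; rewrite opprK.
  have de := @is_derive1_comp R expR (fun y => - y^-1) x _ _ (is_derive_expR _) dN.
  have dpe := is_deriveM dp de.
  apply: (@near_eq_is_derive _ _ _ (fun y : R => p.[y^-1] * expR (- y^-1))).
    near=> y; rewrite /flat_exp ifT//; near: y.
    exact: lt_nbhsr.
  apply: is_derive_eq dpe _.
  rewrite /flat_exp x0 /q /= !hornerE /GRing.scale/=.
  rewrite exprVn; ring.
- rewrite {2}/flat_exp ltxx.
  have [C HC] := horner_le_expR ('X^2 * p).
  have fC (y : R) : `|flat_exp p y| <= `|C| * y ^+ 2.
    rewrite /flat_exp; case: ifPn => [y0|_]; last first.
      by rewrite normr0 mulr_ge0 ?sqr_ge0.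
    have yV0 : 0 <= y^-1 by rewrite invr_ge0 ltW.
    have := HC _ yV0; rewrite hornerM hornerXn normrM normrX (ger0_norm yV0) => Cy.
    rewrite normrM (ger0_norm (expR_ge0 _)) expRN.
    rewrite ler_pdivrMr ?expR_gt0//.
    have y2 : 0 < y ^+ 2 by rewrite exprn_gt0.
    move: Cy; rewrite exprVn ler_pdivrMl// => /le_trans; apply.
    rewrite mulrCA mulrA ler_wpM2r ?expR_ge0// ler_wpM2r ?ler_norm//.
    exact: ltW.
  have f00 : flat_exp p 0 = 0 by rewrite /flat_exp ltxx.
  have H : h^-1 *: (flat_exp p (h *: 1 + 0) - flat_exp p 0) @[h --> (0 : R)^'] --> (0 : R).
    apply/cvgrPdist_le => e e0; near=> h.
    have h0 : h != 0 by near: h; exact: nbhs_dnbhs_neq.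
    rewrite f00 sub0r subr0 addr0 /GRing.scale/= mulr1 normrN normrM normfV.
    rewrite ler_pdivrMl ?normr_gt0// (le_trans (fC h))//.
    rewrite -(real_normK (num_real h)) expr2 mulrCA ler_wpM2l//.
    apply: (@le_trans _ _ ((`|C| + 1) * `|h|)); first by rewrite ler_wpM2r// lerDl.
    rewrite -ler_pdivlMl ?ltr_wpDl// mulrC.
    near: h; apply: dnbhs0_le; rewrite divr_gt0// ltr_wpDl//.
  by apply: DeriveDef; [apply/cvg_ex; exists 0|exact: cvg_lim H].
Unshelve. all: end_near. Qed.

Lemma smoothn_flat_exp n p : smoothn n (flat_exp p).
Proof.
elim: n p => [|n IH] p; first exact: smoothn0.
by apply: smoothnS; [exact: is_derive_flat_exp|exact: IH].
Qed.

Definition smooth_bump (x : R) := flat_exp 1 x * flat_exp 1 (1 - x).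

Lemma smoothn_smooth_bump n (a : R) : smoothn n (fun x => smooth_bump (a * x)).
Proof.
apply: smoothnM.
  have := @smoothn_affine n a 0 _ (@smoothn_flat_exp n 1).
  by under [X in smoothn _ X -> _]eq_fun do rewrite addr0.
have := @smoothn_affine n (- a) 1 _ (@smoothn_flat_exp n 1).
by under [X in smoothn _ X -> _]eq_fun do rewrite mulNr addrC.
Qed.

Lemma flat_exp1_itv x : 0 <= flat_exp 1 x <= 1.
Proof.
rewrite /flat_exp; case: ifPn => [x0|_]; last by rewrite lexx ler01.
by rewrite hornerC mul1r expR_ge0/= -expR0 ler_expR oppr_le0 invr_ge0 ltW.
Qed.

Lemma smooth_bump_ge0 x : 0 <= smooth_bump x.
Proof. by rewrite mulr_ge0//; case/andP: (flat_exp1_itv x); case/andP: (flat_exp1_itv (1 - x)). Qed.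

Lemma smooth_bump_le1 x : smooth_bump x <= 1.
Proof.
have /andP[? ?] := flat_exp1_itv x; have /andP[? ?] := flat_exp1_itv (1 - x).
exact: mulr_ile1.
Qed.

Lemma smooth_bump_eq0 x : ~~ (0 < x < 1) -> smooth_bump x = 0.
Proof.
rewrite negb_and /smooth_bump /flat_exp subr_gt0 => /orP[]/negbTE ->; first by rewrite mul0r.
by rewrite mulr0.
Qed.

(** On the middle half both 1/x and 1/(1 - x) are at most 4, and the exponents add up to at least
    -8. *)
Lemma smooth_bump_ge x : 1/4 <= x <= 3/4 -> expR (-8) <= smooth_bump x.
Proof.
move=> /andP[x1 x2]; rewrite /smooth_bump /flat_exp !ifT; [|lra..].
rewrite !hornerC !mul1r -expRD ler_expR -opprD lerN2.
have h (y : R) : 1/4 <= y -> y^-1 <= 4.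
  by move=> y4; rewrite invf_ple ?posrE; lra.
have := h x x1; have : (1 - x)^-1 <= 4 by apply: h; lra.
by lra.
Qed.

End smooth.

(** * Mollification: smoothness and support *)

Section mollification.
Context (R : realType).
Notation mu := (@lebesgue_measure R).
Implicit Types (f g v rho phi : R -> R).

Lemma smoothn_continuous f : smoothn 1 f -> continuous f.
Proof.
move=> f1 x; apply: differentiable_continuous; apply/derivable1_diffP.
exact: f1 0%N _ x.
Qed.

Lemma smoothn_measurable f : smoothn 1 f -> measurable_fun setT f.
Proof. by move=> f1; apply: continuous_measurable_fun; exact: smoothn_continuous. Qed.

Definition supported_in (A : R) f := forall x, A < `|x| -> f x = 0.

Lemma supported_in_derive1 A f : supported_in A f -> supported_in A (derive1 f).
Proof.
move=> fA x Ax; rewrite derive1E (@near_eq_derive _ _ _ f (cst 0)) ?derive_cst//.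
have : \forall y \near x, A < `|y|.
  exact: (@cvgr_norm_gt R R^o R (nbhs x) _ id x (fun _ h => h) A Ax).
by apply: filterS => y /fA.
Qed.

Lemma continuous_supported_bounded A f : continuous f -> supported_in A f ->
  exists C : R, forall x, `|f x| <= C.
Proof.
move=> cf fA.
(* [A] may be negative, in which case [f] vanishes everywhere; the absolute value keeps the interval
   nonempty. *)
have AA : - `|A| <= `|A| by rewrite ge0_cp.
have cnf : {within `[- `|A|, `|A|], continuous (fun x => `|f x|)}.
  by apply: continuous_subspaceT => x; apply: cvg_norm; exact: cf.
have [c _ cP] := EVT_max AA cnf.
exists `|f c| => x; have [xA|xA] := leP `|x| `|A|.
  by apply: cP; rewrite in_itv/= -ler_norml.
by rewrite fA ?normr0// (le_lt_trans (ler_norm A)).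
Qed.

Lemma bounded_supported_integrable (A C : R) f : measurable_fun setT f ->
  (forall x, `|f x| <= C) -> supported_in A f -> mu.-integrable setT (EFin \o f).
Proof.
move=> mf fC fA.
have C0 : 0 <= C := le_trans (normr_ge0 _) (fC 0).
apply: (@integrable_dominated _ _ _ mu f (fun x => C * \1_(`[- `|A|, `|A|]%classic : set R) x)) => //.
  move=> x; rewrite indicE; have [xA|xA] := leP `|x| `|A|.
    by rewrite mem_set ?mulr1//= in_itv/= -ler_norml.
  by rewrite fA ?normr0 ?mulr_ge0// (le_lt_trans (ler_norm A)).
have := integrableZl measurableT C (integrable_indic_itv (- `|A|) `|A| true false).
by apply: eq_integrable.
Qed.

(** The kernel is evaluated at s - x rather than x - s: with t = s - x this is the average of the
    translates v(x + t) with weight rho(t). Each derivative in x costs a factor -1. *)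
Definition mollify rho v (x : R) : R := (\int[mu]_s (rho (s - x) * v s))%R.

(** Differentiation under the integral sign, dominated by sup |rho'| times |v|, which is integrable
    since v is bounded with bounded support. Two orders of smoothness make rho' continuous, hence
    bounded. *)
Lemma is_derive_mollify (A B C : R) rho v x : smoothn 2 rho -> supported_in A rho ->
  measurable_fun setT v -> (forall s, `|v s| <= C) -> supported_in B v ->
  is_derive x (1 : R) (mollify rho v) (mollify (fun y => -1 * derive1 rho y) v x).
Proof.
move=> rho2 rhoA mv vC vB.
have iv := bounded_supported_integrable mv vC vB.
have mrho := smoothn_measurable (smoothn_pred rho2).
have [D rhoD] : exists D : R, forall x, `|rho x| <= D.
  apply: (@continuous_supported_bounded A) => //.
  exact/smoothn_continuous/smoothn_pred.
have [D' rhoD'] : exists D : R, forall x, `|derive1 rho x| <= D.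
  apply: (@continuous_supported_bounded A).
    exact/smoothn_continuous/smoothn_derive.
  exact: supported_in_derive1.
have der (y s : R) : is_derive y (1 : R) (fun y => rho (s - y) * v s)
    (-1 * derive1 rho (s - y) * v s).
  have d1 : is_derive y (1 : R) (fun y => s - y) (-1).
    by have := is_deriveB (is_derive_cst s y (1 : R)) (is_derive_id y (1 : R)); rewrite sub0r.
  have d2 := @is_derive1_comp R rho (fun y => s - y) y _ _ (smoothn_is_derive (smoothn_pred rho2) _) d1.
  have d3 := is_deriveM d2 (is_derive_cst (v s) y 1).
  by apply: is_derive_eq d3 _; rewrite /GRing.scale/=; ring.
have int_rho (y : R) : mu.-integrable setT (EFin \o (fun s => rho (s - y) * v s)).
  apply: (@integrable_dominated _ _ _ mu (fun s => rho (s - y) * v s) (fun s => D * `|v s|)).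
  - apply: measurable_funM => //; apply: measurableT_comp => //.
    exact: measurable_funB.
  - by move=> s; rewrite normrM ler_wpM2r.
  - have := integrableZl measurableT D (integrable_norm iv).
    by apply: eq_integrable.
have xI : `]x - 1, x + 1[%classic x by rewrite /= in_itv/=; apply/andP; split; lra.
have iG : mu.-integrable setT (EFin \o (fun s => D' * `|v s|)).
  have := integrableZl measurableT D' (integrable_norm iv).
  by apply: eq_integrable.
have D'0 : 0 <= D' by exact: le_trans (rhoD' 0).
have parE : partial1of2 (fun y s => rho (s - y) * v s) =
    (fun y s => -1 * derive1 rho (s - y) * v s).
  by apply/funext => y; apply/funext => s; rewrite partial1of2E derive_val.
have H1 y s : `]x - 1, x + 1[%classic y -> setT s ->
    derivable (fun y => rho (s - y) * v s) y (1 : R).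
  by move=> _ _; case: (der y s).
have H2 y s : `]x - 1, x + 1[%classic y -> setT s ->
    `|partial1of2 (fun y s => rho (s - y) * v s) y s| <= D' * `|v s|.
  by move=> _ _; rewrite parE !normrM normrN1 mul1r ler_wpM2r.
have G0 s : 0 <= D' * `|v s| by rewrite mulr_ge0.
apply: DeriveDef.
  exact: (derivable_under_integral measurableT xI (fun y _ => int_rho y) H1 G0 iG H2).
rewrite -derive1E.
rewrite [LHS](differentiation_under_integral measurableT xI (fun y _ => int_rho y) H1 G0 iG H2).
by rewrite parE.
Qed.

(** The induction on [n] keeps the kernel general: differentiating replaces rho by -rho', which is
    again smooth with the same support bound. *)
Lemma smoothn_mollify (A B C : R) rho v n : (forall m, smoothn m rho) ->
  supported_in A rho -> measurable_fun setT v -> (forall s, `|v s| <= C) ->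
  supported_in B v -> smoothn n (mollify rho v).
Proof.
move=> + + mv vC vB; elim: n rho => [|n IH] rho rho_smooth rhoA; first exact: smoothn0.
apply: smoothnS => [x|].
  exact: (is_derive_mollify x (rho_smooth 2%N) rhoA mv vC vB).
apply: IH.
  move=> m; apply: smoothnM; first exact: smoothn_cst.
  exact/smoothn_derive/rho_smooth.
by move=> x Ax; rewrite (supported_in_derive1 rhoA)// mulr0.
Qed.

Lemma supported_in_mollify A B rho v : supported_in A rho -> supported_in B v ->
  supported_in (A + B) (mollify rho v).
Proof.
move=> rhoA vB x ABx; rewrite /mollify; under eq_Rintegral => s _.
  rewrite (_ : rho (s - x) * v s = 0); last first.
    have [As|sA] := ltP A `|s - x|; first by rewrite rhoA// mul0r.
    rewrite (vB s) ?mulr0// ltNge; apply/negP => sB; move: ABx.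
    rewrite ltNge => /negP; apply; rewrite -(subKr s x) (le_trans (ler_normB _ _))//.
    by rewrite addrC lerD.
  over.
by rewrite /Rintegral integral0.
Qed.

Lemma test_function_supported A f : (forall n, smoothn n f) -> supported_in A f ->
  test_function f.
Proof.
move=> fs fA; split; first by move=> n x; exact: (fs n.+1).
apply: (@subclosed_compact _ _ (`[- A, A]%classic : set R)).
- exact: closed_closure.
- exact: segment_compact.
- have /closure_id -> : closed (`[- A, A]%classic : set R) by exact: itv_closed.
  apply: closure_subset => x /= fx; rewrite in_itv/= -ler_norml leNgt.
  by apply/negP => /fA/eqP; exact/negP.
Qed.

Lemma test_function_smoothn phi n : test_function phi -> smoothn n phi.
Proof. by move=> [phis _] k _ x; exact: phis. Qed.

Lemma supported_test_function phi : test_function phi -> exists A, supported_in A phi.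
Proof.
move=> [_ /compact_bounded[M [_ MP]]]; exists (M + 1) => x Mx.
apply/eqP/negPn/negP => phix.
have M1 : M < M + 1 by rewrite ltrDl.
by have := MP _ M1 x (@subset_closure _ [set y | phi y != 0] x phix); rewrite /= leNgt Mx.
Qed.

End mollification.

(** * Difference quotients of test functions lie in L^2 of the plane *)

Section energy.
Context (R : realType).
Notation mu := (@lebesgue_measure R).
Notation mu2 := (mu \x mu)%E.
Implicit Types (f g v phi : R -> R).

(* On the diagonal, a null set, the quotient is 0. *)
Definition dquot f (z : R * R) := (f z.1 - f z.2) / `|z.1 - z.2|.

Lemma measurable_dist_inv : measurable_fun setT (fun z : R * R => `|z.1 - z.2|^-1).
Proof.
under eq_fun do rewrite -powR_inv1//.
apply: (measurableT_comp (measurable_powR (-1))) => //.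
by apply: measurableT_comp => //; exact: measurable_funB.
Qed.

Lemma measurable_dquot f : measurable_fun setT f -> measurable_fun setT (dquot f).
Proof.
move=> mf; apply: measurable_funM; last exact: measurable_dist_inv.
by apply: measurable_funB; apply: measurableT_comp.
Qed.

Lemma oneDsqr_ge0 (x : R) : 0 <= oneDsqr x.
Proof. by rewrite (le_trans ler01)// oneDsqr_ge1. Qed.

Lemma measurable_oneDsqrV : measurable_fun setT (fun x : R => (oneDsqr x)^-1).
Proof. exact: (continuous_measurable_fun (@continuous_oneDsqrV R)). Qed.

(** The value on [0, +oo[ is known, and the integrand is even, so the negative half-line follows by
    the substitution x to -x. *)
Lemma integral_oneDsqrV_lty : (\int[mu]_x ((oneDsqr x)^-1)%:E < +oo)%E.
Proof.
have mo : measurable_fun setT (fun x : R => (oneDsqr x)^-1%:E).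
  apply/measurable_EFinP. exact: measurable_oneDsqrV.
have o0 x : (0 <= (oneDsqr x : R)^-1%:E)%E by rewrite lee_fin invr_ge0 oneDsqr_ge0.
have fin : (\int[mu]_(x in `[0%R, +oo[) (oneDsqr x)^-1%:E < +oo)%E.
  by rewrite integral0y_oneDsqr ltry.
apply: (@le_lt_trans _ _ (\int[mu]_(x in `]-oo, 0%R]) (oneDsqr x)^-1%:E +
   \int[mu]_(x in `[0%R, +oo[) (oneDsqr x)^-1%:E)%E).
  rewrite -(setUv `]-oo, 0%R]%classic) ge0_integral_setU//.
  - rewrite leeD2l// ge0_subset_integral//; first exact: measurableC.
      exact: measurable_funTS.
    move=> x /=; rewrite !in_itv/= andbT => /negP; rewrite -ltNge; exact: ltW.
  - exact: measurableC.
  - by rewrite setUv.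
  - by rewrite disj_set2E setICr.
apply: lte_add_pinfty => //; move: fin.
rewrite ge0_integration_by_substitution0//.
by under eq_integral => x _ do rewrite /oneDsqr sqrrN.
Qed.

(** Provides the dominating function for the squared quotient of a test function: 1 / (1 + (x -
    y)^2) has the same finite integral in y for every x, and x stays in a bounded interval. *)
Lemma cauchy_kernel_lty (a b k : R) : 0 <= k ->
  (\int[mu2]_z (k * \1_(`[a, b]%classic : set R) z.1 *
     (oneDsqr (z.1 - z.2))^-1)%:E < +oo)%E.
Proof.
move=> k0.
have mo : measurable_fun setT (fun x : R => (oneDsqr x)^-1).
  exact: measurable_oneDsqrV.
have m1 : measurable_fun setT (\1_(`[a, b]%classic : set R) : R -> R) by exact: measurable_indic.
rewrite fubini_tonelli1; last 2 first.
- apply/measurable_EFinP; apply: measurable_funM.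
    by apply: measurable_funM => //; apply: measurableT_comp.
  by apply: (measurableT_comp mo); exact: measurable_funB.
- by move=> z; rewrite lee_fin !mulr_ge0// ?invr_ge0 ?oneDsqr_ge0// indicE.
rewrite /fubini_F/=.
have [c c0 cE] : exists2 c : R, 0 <= c & (\int[mu]_x ((oneDsqr x)^-1)%:E = c%:E)%E.
  exists (fine (\int[mu]_x ((oneDsqr x)^-1)%:E)%E).
    by rewrite fine_ge0// integral_ge0// => x _; rewrite lee_fin invr_ge0 oneDsqr_ge0.
  rewrite fineK// ge0_fin_numE ?integral_oneDsqrV_lty//.
  by rewrite integral_ge0// => x _; rewrite lee_fin invr_ge0 oneDsqr_ge0.
have inner x : (\int[mu]_y (k * \1_(`[a, b]%classic : set R) x * (oneDsqr (x - y))^-1)%:E =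
    ((k * c) * \1_(`[a, b]%classic : set R) x)%:E)%E.
  under eq_integral do rewrite EFinM.
  rewrite ge0_integralZl_EFin//; last 2 first.
  - by apply/measurable_EFinP; apply: (measurableT_comp mo); exact: measurable_funB.
  - by rewrite mulr_ge0// indicE.
  rewrite mulrAC [RHS]EFinM; congr (_ * _)%E.
  rewrite -cE -[RHS](integral_shift (- x)); last exact/measurable_EFinP.
  by apply: eq_integral => y _; rewrite /oneDsqr -sqrrN opprB.
under eq_integral do rewrite inner.
have := integrableZl measurableT (k * c) (integrable_indic_itv a b true false).
move=> /integrableP[_]; apply: le_lt_trans; rewrite le_eqVlt; apply/orP; left.
apply/eqP; apply: eq_integral => x _ /=.
by rewrite ger0_norm ?EFinM// !mulr_ge0// indicE.
Qed.

Lemma test_function_lipschitz phi : test_function phi ->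
  exists2 L : R, 0 <= L & forall x y, `|phi x - phi y| <= L * `|x - y|.
Proof.
move=> tphi; have [A phiA] := supported_test_function tphi.
have [L LP] : exists L : R, forall x, `|derive1 phi x| <= L.
  apply: (@continuous_supported_bounded _ A); last exact: supported_in_derive1.
  exact/smoothn_continuous/smoothn_derive/test_function_smoothn.
exists L; first exact: le_trans (LP 0).
have cphi : continuous phi by exact/smoothn_continuous/test_function_smoothn.
have H x y : x < y -> `|phi x - phi y| <= L * `|x - y|.
  move=> xy; have [||c _] := @MVT R phi (derive1 phi) x y xy.
  - by move=> z _; apply: smoothn_is_derive; exact: (test_function_smoothn (n := 1)).
  - exact: continuous_subspaceT.
  by rewrite distrC (distrC x) => ->; rewrite normrM ler_wpM2r.
move=> x y; have [xy|yx|->] := ltgtP x y; first exact: H.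
  by rewrite distrC (distrC x); exact: H.
by rewrite !subrr normr0 mulr0.
Qed.

Lemma test_function_bounded phi : test_function phi ->
  exists C : R, forall x, `|phi x| <= C.
Proof.
move=> tphi; have [A phiA] := supported_test_function tphi.
apply: (@continuous_supported_bounded _ A) => //.
exact/smoothn_continuous/test_function_smoothn.
Qed.

(** The squared quotient is at most L^2 by the Lipschitz bound and at most 4 C^2 / (x - y)^2 by the
    sup bound, hence at most k / (1 + (x - y)^2). It vanishes unless x or y lies in [-A, A]; these
    two cases account for [h] and its swap in the dominating function. *)
Lemma dquot_test_function phi : test_function phi ->
  square_integrable mu2 (dquot phi).
Proof.
move=> tphi; have [A phiA] := supported_test_function tphi.
have [L L0 phiL] := test_function_lipschitz tphi.
have [C phiC] := test_function_bounded tphi.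
have C0 : 0 <= C := le_trans (normr_ge0 _) (phiC 0).
have mphi : measurable_fun setT phi.
  by apply: smoothn_measurable; exact: test_function_smoothn.
(* Write s = x - y. If s^2 <= 1 then L^2 (1 + s^2) <= 2 L^2; otherwise 4 C^2 (1 + s^2) <= 8 C^2
   s^2. *)
pose k := 2 * L ^+ 2 + 8 * C ^+ 2.
have k0 : 0 <= k by rewrite addr_ge0// mulr_ge0// sqr_ge0.
pose I : set R := `[- A, A]%classic.
pose h (z : R * R) : R := k * \1_I z.1 * (oneDsqr (z.1 - z.2))^-1.
have h0 z : 0 <= h z by rewrite !mulr_ge0// ?invr_ge0 ?oneDsqr_ge0// indicE.
have mI : measurable_fun setT (\1_I : R -> R) by apply: measurable_indic; exact: measurable_itv.
have mh : measurable_fun setT h.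
  apply: measurable_funM.
    by apply: measurable_funM => //; exact: (measurableT_comp mI).
  by apply: (measurableT_comp measurable_oneDsqrV); exact: measurable_funB.
have hi : mu2.-integrable setT (EFin \o h).
  by apply: ge0_integrable => //; exact: cauchy_kernel_lty.
have hi' : mu2.-integrable setT (EFin \o (fun z => h (z.2, z.1))).
  have mswap : measurable_fun setT (fun z : R * R => (z.2, z.1)).
    by apply/measurable_fun_pairP; split; [exact: measurable_snd|exact: measurable_fst].
  apply: ge0_integrable => //.
    exact: (measurableT_comp mh).
  have := @integral_swap R (EFin \o h); rewrite /= => ->; last exact/measurable_EFinP.
  exact: cauchy_kernel_lty.
apply: (@square_integrable_le _ _ _ mu2 (dquot phi) (fun z => h z + h (z.2, z.1))).
- exact: measurable_dquot.
- move=> [x y]; rewrite /h /dquot expr_div_n real_normK ?num_real//=.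
  have [->|xy] := eqVneq x y.
    by rewrite subrr expr0n/= mul0r -[leRHS]/(h (y, y) + h (y, y)) addr_ge0.
  have xy2 : 0 < (x - y) ^+ 2 by rewrite exprn_even_gt0// subr_eq0.
  have yxE : oneDsqr (y - x) = oneDsqr (x - y) by rewrite /oneDsqr -sqrrN opprB.
  have o0 : 0 < oneDsqr (x - y) by rewrite /oneDsqr; lra.
  rewrite yxE -mulrDl -mulrDr ler_pdivrMr// mulrAC ler_pdivlMr//.
  have [xA|xA] := boolP ((`|x| <= A) || (`|y| <= A)); last first.
    move: xA; rewrite negb_or -!ltNge => /andP[xA yA].
    rewrite !phiA// subrr expr0n/= mul0r; apply: mulr_ge0 (sqr_ge0 _).
    by apply: mulr_ge0 => //; apply: addr_ge0; rewrite indicE.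
  apply: (@le_trans _ _ (k * (x - y) ^+ 2)); last first.
    have I1 w : `|w| <= A -> \1_I w = 1 :> R.
      by move=> wA; rewrite indicE mem_set// /I/= in_itv/= -ler_norml.
    have I0 w : 0 <= \1_I w :> R by rewrite indicE.
    rewrite ler_wpM2r ?sqr_ge0// ler_peMr//.
    by case/orP: xA => /I1 ->; rewrite ?lerDl ?lerDr I0.
  have D1 : (phi x - phi y) ^+ 2 <= L ^+ 2 * (x - y) ^+ 2.
    rewrite -exprMn -(real_normK (num_real (phi x - phi y))).
    rewrite -(real_normK (num_real (L * (x - y)))) lerXn2r ?nnegrE//.
    by rewrite normrM (ger0_norm L0).
  have D2 : (phi x - phi y) ^+ 2 <= 4 * C ^+ 2.
    rewrite (_ : 4 * C ^+ 2 = (C + C) ^+ 2); last by ring.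
    rewrite -(real_normK (num_real (phi x - phi y))) lerXn2r ?nnegrE ?addr_ge0//.
    by rewrite (le_trans (ler_normB _ _))// lerD.
  rewrite /oneDsqr /k; move: D1 D2 xy2; move: (x - y) (phi x - phi y) => s t.
  move: (sqr_ge0 t) (sqr_ge0 C) (sqr_ge0 L).
  move: (s ^+ 2) (t ^+ 2) (L ^+ 2) (C ^+ 2) => s2 t2 l c t20 c0 l0 D1 D2 s20.
  have [s1|s1] := leP s2 1; nra.
- have := integrableD measurableT hi hi'.
  by apply: eq_integrable.
Qed.

End energy.

(** * Mollifiers and Jensen's inequality for them *)

Section mollifier.
Context (R : realType).
Notation mu := (@lebesgue_measure R).
Notation mu2 := (mu \x mu)%E.
Implicit Types (f g v rho phi : R -> R).

(** The constant [k] is to be the same for all [n]: each kernel is then below a fixed multiple of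
    the uniform density on the ball of radius 1/(n + 1), as Lebesgue differentiation requires. *)
Definition mollifier (k : R) (n : nat) rho :=
  [/\ forall m, smoothn m rho,
      forall t, 0 <= rho t <= k * n.+1%:R,
      forall t, ~~ (0 < t < n.+1%:R^-1) -> rho t = 0 &
      (\int[mu]_t (rho t)%:E = 1)%E].

(* The bump is at most 1, and at least [expR (- 8)] on the middle half of its
   support, whence the constant [k = 2 e^8]. *)
Lemma mollifier_exists : exists k : R, forall n, exists rho, mollifier k n rho.
Proof.
exists (2 * expR 8) => n.
pose N : R := n.+1%:R; have N0 : 0 < N by rewrite ltr0n.
pose b (t : R) : R := smooth_bump (N * t).
have b_smooth m : smoothn m b by exact: smoothn_smooth_bump.
have mb : measurable_fun setT b by exact: smoothn_measurable.
have b0 t : 0 <= b t by exact: smooth_bump_ge0.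
have b_supp t : ~~ (0 < t < N^-1) -> b t = 0.
  move=> tN; apply: smooth_bump_eq0; apply: contra tN.
  by rewrite pmulr_rgt0// -ltr_pdivlMl// mulr1.
have ib : mu.-integrable setT (EFin \o b).
  apply: (@bounded_supported_integrable _ 1 1) => //.
    by move=> x; rewrite ger0_norm ?b0// smooth_bump_le1.
  move=> t t1; apply: b_supp; apply/negP => /andP[t0 tN].
  move: t1; rewrite gtr0_norm// ltNge (le_trans (ltW tN))//.
  by rewrite invf_le1// ler1n.
pose c := (\int[mu]_t b t)%R.
have cE : (c%:E = \int[mu]_t (b t)%:E)%E.
  by rewrite /c /Rintegral fineK//; exact: integrable_fin_num ib.
pose I : set R := `[(1 / 4) / N, (3 / 4) / N]%classic.
have c_ge : expR (- 8) / (2 * N) <= c.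
  rewrite -lee_fin cE.
  have := integrableZl measurableT (expR (-8)) (integrable_indic_itv ((1 / 4) / N) ((3 / 4) / N) true false).
  move=> iI; apply: (@le_trans _ _ (\int[mu]_t ((expR (-8))%:E * (\1_I t)%:E))%E).
    rewrite ge0_integralZl_EFin ?expR_ge0//; last first.
      by apply/measurable_EFinP; apply: measurable_indic; exact: measurable_itv.
    rewrite integral_indic ?setIT//; last exact: measurable_itv.
    have muI : (mu I = ((3 / 4) / N - (1 / 4) / N)%:E)%E.
      rewrite /I lebesgue_measure_itv/= lte_fin ltr_pM2r ?invr_gt0//.
      rewrite ifT ?EFinB//; lra.
    rewrite [X in (_ <= _ * X)%E]muI -EFinM lee_fin le_eqVlt; apply/orP; left; apply/eqP.
    by field; rewrite gt_eqF.
  apply: le_integral => //.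
  move=> t _ /=; rewrite -EFinM lee_fin.
  have [tI|tI] := boolP (t \in I); last by rewrite indicE (negbTE tI) mulr0 b0.
  rewrite indicE tI mulr1 /b; apply: smooth_bump_ge.
  move: tI; rewrite inE /I/= in_itv/= => /andP[t1 t2].
  by rewrite (mulrC N) -ler_pdivrMr// t1/= -ler_pdivlMr.
have c0 : 0 < c by rewrite (lt_le_trans _ c_ge)// divr_gt0 ?expR_gt0// mulr_gt0.
exists (fun t => c^-1 * b t); split.
- by move=> m; apply: smoothnM; [exact: smoothn_cst|exact: b_smooth].
- move=> t; rewrite mulr_ge0 ?invr_ge0 ?(ltW c0)//=.
  rewrite ler_pdivrMl// (le_trans (smooth_bump_le1 _))//.
  have := c_ge; rewrite ler_pdivrMr ?mulr_gt0// => H.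
  apply: (@le_trans _ _ (expR 8 * expR (-8))); first by rewrite -expRD subrr expR0.
  apply: le_trans (ler_wpM2l (expR_ge0 8) H) _.
  by rewrite le_eqVlt; apply/orP; left; apply/eqP; rewrite -/N; ring.
- by move=> t tN; rewrite b_supp// mulr0.
- under eq_integral do rewrite EFinM.
  rewrite integralZl// -cE -EFinM mulVf//; exact: lt0r_neq0.
Qed.

Lemma mollifier_supported k n rho : mollifier k n rho -> supported_in 1 rho.
Proof.
move=> [_ _ rho0 _] t t1; apply: rho0; apply/negP => /andP[t0 tN].
move: t1; rewrite gtr0_norm// ltNge (le_trans (ltW tN))//.
by rewrite invf_le1 ?ltr0n// ler1n.
Qed.

Lemma mollifier_measurable k n rho : mollifier k n rho -> measurable_fun setT rho.
Proof. by move=> [rho_smooth _ _ _]; exact: smoothn_measurable. Qed.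

Lemma mollifier_integrable k n rho : mollifier k n rho ->
  mu.-integrable setT (EFin \o rho).
Proof.
move=> mrho; apply: (@bounded_supported_integrable _ 1 (k * n.+1%:R)).
- exact: mollifier_measurable mrho.
- by case: mrho => [_ rhok _ _] t; case/andP: (rhok t) => ? ?; rewrite ger0_norm.
- exact: mollifier_supported mrho.
Qed.

Lemma mollifier_integrableM k n rho f (C : R) : mollifier k n rho ->
  measurable_fun setT f -> (forall t, `|f t| <= C) ->
  mu.-integrable setT (EFin \o (fun t => rho t * f t)).
Proof.
move=> mrho mf fC.
apply: (@integrable_dominated _ _ _ mu (fun t => rho t * f t) (fun t => C * rho t)).
- by apply: measurable_funM => //; exact: mollifier_measurable mrho.
- case: mrho => [_ rhok _ _] t; case/andP: (rhok t) => ? ?.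
  by rewrite normrM ger0_norm// mulrC ler_wpM2r.
- have := integrableZl measurableT C (mollifier_integrable mrho).
  by apply: eq_integrable.
Qed.

Lemma mollify_shiftE k n rho v (C : R) x : mollifier k n rho ->
  measurable_fun setT v -> (forall t, `|v t| <= C) ->
  ((mollify rho v x)%:E = \int[mu]_t (rho t * v (t + x))%:E)%E.
Proof.
move=> mrho mv vC.
have mvx : measurable_fun setT (fun t : R => v (t + x)).
  by apply: (measurableT_comp mv); exact: measurable_funD.
have mvx' : measurable_fun setT (fun s : R => rho (s - x) * v s).
  apply: measurable_funM => //.
  apply: (measurableT_comp (mollifier_measurable mrho)); exact: measurable_funB.
have := @integral_shift R x (fun s : R => (rho (s - x) * v s)%:E) _.
move=> /(_ ((measurable_EFinP _ _).2 mvx')) E.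
rewrite /mollify /Rintegral fineK.
  by rewrite -E; apply: eq_integral => t _; rewrite addrK.
rewrite -E.
have -> : (fun t : R => (rho (t + x - x) * v (t + x))%:E) = EFin \o (fun t => rho t * v (t + x)).
  by apply/funext => t /=; rewrite addrK.
exact/integrable_fin_num/(mollifier_integrableM mrho mvx (fun t => vC _)).
Qed.

(** Since rho has mass 1, this is the nonnegativity of the variance: expand the integral of rho (f -
    a)^2, where a is the integral of rho f. *)
Lemma mollifier_jensen k n rho f (C : R) : mollifier k n rho ->
  measurable_fun setT f -> (forall t, `|f t| <= C) ->
  ((\int[mu]_t (rho t * f t)%:E) ^+ 2 <= \int[mu]_t (rho t * f t ^+ 2)%:E)%E.
Proof.
move=> mrho mf fC.
have if1 := mollifier_integrableM mrho mf fC.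
have mf2 : measurable_fun setT (fun t => f t ^+ 2) by exact: measurable_funX.
have f2C t : `|f t ^+ 2| <= C ^+ 2.
  by rewrite normrX lerXn2r ?nnegrE// (le_trans _ (fC t)).
have if2 := mollifier_integrableM mrho mf2 f2C.
have [a aE] : exists a : R, (\int[mu]_t (rho t * f t)%:E = a%:E)%E.
  by exists (fine (\int[mu]_t (rho t * f t)%:E)%E); rewrite fineK//; exact: integrable_fin_num if1.
have [b bE] : exists b : R, (\int[mu]_t (rho t * f t ^+ 2)%:E = b%:E)%E.
  by exists (fine (\int[mu]_t (rho t * f t ^+ 2)%:E)%E); rewrite fineK//; exact: integrable_fin_num if2.
rewrite aE bE.
have : (0 <= \int[mu]_t (rho t * (f t - a) ^+ 2)%:E)%E.
  apply: integral_ge0 => t _; rewrite lee_fin mulr_ge0 ?sqr_ge0//.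
  by case: mrho => [_ rhok _ _]; case/andP: (rhok t).
have -> : (\int[mu]_t (rho t * (f t - a) ^+ 2)%:E =
    \int[mu]_t ((rho t * f t ^+ 2)%:E - ((2 * a)%:E * (rho t * f t)%:E - (a ^+ 2)%:E * (rho t)%:E)))%E.
  apply: eq_integral => t _; rewrite -!EFinM -!EFinB; congr EFin; ring.
have i1 := integrableZl measurableT (2 * a) if1.
have i2 := integrableZl measurableT (a ^+ 2) (mollifier_integrable mrho).
rewrite integralB//; last exact: integrableB.
rewrite integralB// !integralZl//; last exact: mollifier_integrable mrho.
case: mrho => [_ _ _ rho1]; rewrite aE bE [X in ((a ^+ 2)%:E * X)%E]rho1.
rewrite mule1 -EFinM -!EFinB !lee_fin; nra.
Qed.

End mollifier.

(** * Bounds, convergence and energy of mollified functions *)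

Section mollified_functions.
Context (R : realType).
Notation mu := (@lebesgue_measure R).
Notation mu2 := (mu \x mu)%E.
Implicit Types (f g v rho phi : R -> R).

Lemma mollify_bounded k n rho v (C : R) x : mollifier k n rho ->
  measurable_fun setT v -> (forall t, `|v t| <= C) -> `|mollify rho v x| <= C.
Proof.
move=> mrho mv vC; rewrite -lee_fin.
have mvx : measurable_fun setT (fun t : R => v (t + x)).
  by apply: (measurableT_comp mv); exact: measurable_funD.
have i1 := mollifier_integrableM mrho mvx (fun t => vC (t + x)).
rewrite -abse_EFin (mollify_shiftE x mrho mv vC).
apply: (le_trans (le_abse_integral _ _ _)) => //.
  by case/integrableP: i1.
have i2 := integrableZl measurableT C (mollifier_integrable mrho).
apply: (@le_trans _ _ (\int[mu]_t (C%:E * (rho t)%:E))%E).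
  apply: le_integral => //.
    exact: (integrable_abse i1).
  move=> t _; rewrite /= lee_fin; case: mrho => [_ rhok _ _].
  by case/andP: (rhok t) => ? ?; rewrite normrM ger0_norm// mulrC ler_wpM2r.
rewrite integralZl//; last exact: mollifier_integrable mrho.
by case: mrho => [_ _ _ rho1]; rewrite [X in (C%:E * X)%E]rho1 mule1.
Qed.

Lemma mollify_test_function k n rho v (B C : R) : mollifier k n rho ->
  measurable_fun setT v -> (forall t, `|v t| <= C) -> supported_in B v ->
  test_function (mollify rho v).
Proof.
move=> mrho mv vC vB; have rho1 := mollifier_supported mrho.
apply: (@test_function_supported _ (1 + B)).
  by move=> m; apply: smoothn_mollify rho1 mv vC vB; case: mrho.
exact: supported_in_mollify.
Qed.

(** At a Lebesgue point x, mass 1 and the bound k (n + 1) on the kernel give |v_n(x) - v(x)| <= 2 k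
    times the mean of |v - v(x)| over the ball of radius 1/(n + 1) around x. The 2 comes from the
    length 2/(n + 1) of that ball. *)
Lemma mollify_cvg k (rho_ : nat -> R -> R) v (B C : R) :
  (forall n, mollifier k n (rho_ n)) ->
  measurable_fun setT v -> (forall t, `|v t| <= C) -> supported_in B v ->
  {ae mu, forall x, mollify (rho_ n) v x @[n --> \oo] --> v x}.
Proof.
move=> mrho mv vC vB.
have iv := bounded_supported_integrable mv vC vB.
have := lebesgue_differentiation (open_integrable_locally openT iv).
apply: filterS; first exact: (ae_filter_ringOfSetsType mu).
move=> x xL.
have k0 : 0 <= k.
  case: (mrho 0%N) => [_ /(_ 0) /andP[r0 rk] _ _].
  by rewrite -(mulr1 k) (le_trans r0).
have xL' : davg v x n.+1%:R^-1 @[n --> \oo] --> 0%E.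
  apply: cvg_comp xL => A [e /= e0 eA].
  near=> n; apply: eA => /=; last by rewrite invr_gt0.
  rewrite sub0r normrN gtr0_norm ?invr_gt0//.
  by near: n; exact: near_infty_natSinv_lt (PosNum e0).
have vxb t : `|v (t + x) - v x| <= C + C.
  by rewrite (le_trans (ler_normB _ _))// lerD.
have mvx : measurable_fun setT (fun t : R => v (t + x) - v x).
  by apply: measurable_funB => //; apply: (measurableT_comp mv); exact: measurable_funD.
have key n : (`|mollify (rho_ n) v x - v x|%:E <= (2 * k)%:E * davg v x n.+1%:R^-1)%E.
  pose N : R := n.+1%:R; have N0 : 0 < N by rewrite ltr0n.
  have i1 := mollifier_integrableM (mrho n) mvx vxb.
  have E : ((mollify (rho_ n) v x - v x)%:E = \int[mu]_t (rho_ n t * (v (t + x) - v x))%:E)%E.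
    have mvx' : measurable_fun setT (fun t : R => v (t + x)).
      by apply: (measurableT_comp mv); exact: measurable_funD.
    have j1 := mollifier_integrableM (mrho n) mvx' (fun t => vC (t + x)).
    have j2 := integrableZl measurableT (v x) (mollifier_integrable (mrho n)).
    transitivity (\int[mu]_t ((rho_ n t * v (t + x))%:E - (v x)%:E * (rho_ n t)%:E))%E.
      rewrite integralB// integralZl//; last exact: mollifier_integrable (mrho n).
      rewrite -(mollify_shiftE x (mrho n) mv vC).
      by case: (mrho n) => [_ _ _ rho1]; rewrite [X in (_ = _ - _ * X)%E]rho1 mule1 EFinB.
    by apply: eq_integral => t _; rewrite -EFinM -EFinB; congr EFin; ring.
  pose F : R -> \bar R := (fun y => `|(v y - v x)%:E|%E) \_ (ball x N^-1).
  have mF : measurable_fun setT F.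
    apply/(measurable_restrictT _ _).1; first exact: measurable_ball.
    apply: measurable_funTS; apply: measurableT_comp => //.
    by apply/measurable_EFinP; exact: measurable_funB.
  have F0 y : (0 <= F y)%E by apply: erestrict_ge0.
  apply: (@le_trans _ _ (\int[mu]_t ((k * N)%:E * F (t + x)%R))%E).
    rewrite -abse_EFin E; apply: (le_trans (le_abse_integral _ _ _)) => //.
      by case/integrableP: i1.
    apply: ge0_le_integral => //.
    - by apply: measurableT_comp => //; case/integrableP: i1.
    - apply: measurable_funeM; apply: (measurableT_comp mF).
      exact: measurable_funD.
    - move=> t _; case: (mrho n) => [_ /(_ t) /andP[r0 rk] /(_ t) rho0 _].
      have [tN|tN] := boolP (0 < t < N^-1); last first.
        by rewrite rho0// mul0r abse0 mule_ge0// lee_fin mulr_ge0.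
      rewrite /F /patch ifT; last first.
        rewrite mem_set// /ball/= opprD addrCA subrr addr0 normrN.
        by case/andP: tN => t0 tN; rewrite gtr0_norm.
      by rewrite abse_EFin -EFinM lee_fin normrM (ger0_norm r0) ler_wpM2r.
  rewrite ge0_integralZl_EFin ?mulr_ge0//; last first.
    by apply: (measurableT_comp mF); exact: measurable_funD.
  rewrite (integral_shift x mF) /F -integral_mkcond.
  rewrite /davg /iavg (lebesgue_measure_ball _ (ltW _)) ?invr_gt0//.
  rewrite inver mulrn_eq0/= invr_eq0 gt_eqF// muleA -EFinM.
  rewrite le_eqVlt; apply/orP; left; apply/eqP; congr (_%:E * _)%E.
  by rewrite -mulr_natr; field; rewrite gt_eqF.
have kd : ((2 * k)%:E * davg v x n.+1%:R^-1)%E @[n --> \oo] --> 0%E.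
  by rewrite -(mule0 (2 * k)%:E); apply: cvgeZl.
have : (`|mollify (rho_ n) v x - v x|%:E)%E @[n --> \oo] --> 0%E.
  apply: squeeze_cvge (cvg_cst _) kd; near=> n.
  by rewrite key lee_fin normr_ge0.
move/fine_cvgP => [_ /norm_cvg0 h].
exact/subr_cvg0.
Unshelve. all: end_near. Qed.

(** Difference quotients commute with translations, so D(v_n)(x, y) is the average of D v(x + t, y +
    t) with weight rho(t). After Jensen and Tonelli, the integral over the plane is the same for
    every t by invariance under diagonal translation. *)
Lemma dquot_mollify_le k n rho v (B C : R) : mollifier k n rho ->
  measurable_fun setT v -> (forall t, `|v t| <= C) -> supported_in B v ->
  square_integrable mu2 (dquot v) ->
  (\int[mu2]_z (dquot (mollify rho v) z ^+ 2)%:E <=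
   \int[mu2]_z (dquot v z ^+ 2)%:E)%E.
Proof.
move=> mrho mv vC vB [mdv dvoo].
have rho0 t : 0 <= rho t by case: mrho => [_ rhok _ _]; case/andP: (rhok t).
have mrho' := mollifier_measurable mrho.
have mc : measurable_fun setT (mollify rho v).
  apply: smoothn_measurable; apply: test_function_smoothn.
  exact: mollify_test_function mrho mv vC vB.
pose f (w : (R * R) * R) : R := rho w.2 * dquot v (w.1.1 + w.2, w.1.2 + w.2) ^+ 2.
have mf : measurable_fun setT f.
  apply: measurable_funM; first exact: (measurableT_comp mrho').
  apply: measurable_funX; apply: (measurableT_comp mdv).
  apply/measurable_fun_pairP; split; apply: measurable_funD => //;
    by apply: measurableT_comp.
have f0 w : 0 <= f w by rewrite mulr_ge0// sqr_ge0.
apply: (@le_trans _ _ (\int[mu2]_z \int[mu]_t (f (z, t))%:E)%E).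
  apply: ge0_le_integral => //.
  - by move=> z _; rewrite lee_fin sqr_ge0.
  - by apply/measurable_EFinP; apply: measurable_funX; exact: measurable_dquot.
  - by apply: (@measurable_fun_fubini_tonelli_F _ _ _ _ _ mu (EFin \o f)) => //;
      exact/measurable_EFinP.
  - move=> [x y] _.
    pose D t := dquot v (x + t, y + t).
    have mD : measurable_fun setT D.
      apply: (measurableT_comp mdv); apply/measurable_fun_pairP.
      by split; exact: measurable_funD.
    (* Jensen asks for a bound in [t] at fixed x and y only, so it may blow up near the diagonal. On
       the diagonal both sides are 0, since 0^-1 = 0. *)
    have DC t : `|D t| <= (C + C) / `|x - y|.
      rewrite /D /dquot/= opprD addrACA subrr addr0 normrM normfV normr_id.
      by rewrite ler_wpM2r ?invr_ge0// (le_trans (ler_normB _ _))// lerD.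
    have -> : ((dquot (mollify rho v) (x, y) ^+ 2)%:E = (\int[mu]_t (rho t * D t)%:E) ^+ 2)%E.
      rewrite EFin_expe; congr (_ ^+ 2)%E.
      have mvs (w : R) : measurable_fun setT (fun t : R => v (t + w)).
        by apply: (measurableT_comp mv); exact: measurable_funD.
      have i1 := mollifier_integrableM mrho (mvs x) (fun t => vC (t + x)).
      have i2 := mollifier_integrableM mrho (mvs y) (fun t => vC (t + y)).
      rewrite /dquot/= mulrC EFinM EFinB.
      rewrite !(mollify_shiftE _ mrho mv vC) -integralB// -integralZl//; last exact: integrableB.
      apply: eq_integral => t _; rewrite -EFinB -EFinM /D /dquot/= opprD addrACA subrr addr0.
      by rewrite !(addrC t); congr EFin; ring.
    exact: mollifier_jensen mrho mD DC.
have := @tonelli_product _ _ _ _ _ _ R mu mu mu (EFin \o f).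
move=> /(_ ((measurable_EFinP _ _).2 mf) (fun w => f0 w)) /= ->.
have E t : (\int[mu2]_z (f (z, t))%:E = (rho t)%:E * \int[mu2]_z (dquot v z ^+ 2)%:E)%E.
  have md2 : measurable_fun setT (fun z : R * R => (dquot v z ^+ 2)%:E).
    exact/measurable_EFinP/measurable_funX.
  rewrite -(integral_diagonal_shift t md2) -ge0_integralZl_EFin//.
  - by move=> z _; rewrite lee_fin sqr_ge0.
  - apply: (measurableT_comp md2); apply/measurable_fun_pairP.
    by split; apply: measurable_funD.
under eq_integral do rewrite E.
rewrite ge0_integralZr//.
- by case: mrho => [_ _ _ rho1]; rewrite [X in (X * _)%E]rho1 mul1e.
- exact/measurable_EFinP.
- by move=> t _; rewrite lee_fin.
- by apply: integral_ge0 => z _; rewrite lee_fin sqr_ge0.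
Qed.

End mollified_functions.

(** * Weak equations tested with bounded functions of finite energy *)

Section weak_extension.
Context (R : realType).
Notation mu := (@lebesgue_measure R).
Notation mu2 := (mu \x mu)%E.

Lemma ae_product_fst (P : R -> Prop) : {ae mu, forall x, P x} ->
  {ae mu2, forall z, P z.1}.
Proof.
move=> [A [mA A0 PA]]; exists (A `*` setT); split.
- exact: measurableX.
- by rewrite product_measure1E// [X in (X * _)%E]A0 mul0e.
- by move=> z /= Pz; split=> //; exact: PA.
Qed.

Lemma ae_product_snd (P : R -> Prop) : {ae mu, forall x, P x} ->
  {ae mu2, forall z, P z.2}.
Proof.
move=> [A [mA A0 PA]]; exists (setT `*` A); split.
- exact: measurableX.
- by rewrite product_measure1E// [X in (_ * X)%E]A0 mule0.
- by move=> z /= Pz; split=> //; exact: PA.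
Qed.

(** Serves both equations: [g] is u^i |D u|^2 for the half-harmonic equation and 0 for the
    divergence condition. On the right the mollified functions keep the bound [C], so dominated
    convergence applies with C |g|. *)
Lemma weak_equation_extension (G : R * R -> R) (g v : R -> R) (B C : R) :
  square_integrable mu2 G -> mu.-integrable setT (EFin \o g) ->
  measurable_fun setT v -> (forall t, `|v t| <= C) -> supported_in B v ->
  square_integrable mu2 (dquot v) ->
  (forall phi, test_function phi ->
    (\int[mu2]_z (G z * dquot phi z)%:E = \int[mu]_x (g x * phi x)%:E)%E) ->
  (\int[mu2]_z (G z * dquot v z)%:E = \int[mu]_x (g x * v x)%:E)%E.
Proof.
move=> Gi gi mv vC vB dvi eqn.
have [k kP] := mollifier_exists R.
have [rho_ rhoP] : exists rho_ : nat -> R -> R, forall n, mollifier k n (rho_ n).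
  by exists (fun n => projT1 (cid (kP n))) => n; exact: (projT2 (cid (kP n))).
pose vn n := mollify (rho_ n) v.
have tvn n : test_function (vn n) by exact: mollify_test_function (rhoP n) mv vC vB.
have mvn n : measurable_fun setT (vn n).
  by apply: smoothn_measurable; apply: test_function_smoothn; exact: tvn.
have vnv := mollify_cvg rhoP mv vC vB.
have [M ME] : exists M : R, (\int[mu2]_z (dquot v z ^+ 2)%:E = M%:E)%E.
  exists (fine (\int[mu2]_z (dquot v z ^+ 2)%:E)%E).
  by rewrite fineK//; exact: integrable_fin_num (square_integrable_sqr dvi).
have lhs : (\int[mu2]_z (G z * dquot (vn n) z)%:E)%E @[n --> \oo] -->
    (\int[mu2]_z (G z * dquot v z)%:E)%E.
  apply: (bounded_ae_cvg_weak (M := M)) => //.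
  - by case: dvi.
  - by move=> n; exact: measurable_dquot.
  - by rewrite ME.
  - by move=> n; rewrite -ME; exact: dquot_mollify_le (rhoP n) mv vC vB dvi.
  - have := ae_product_fst vnv; have := ae_product_snd vnv.
    apply: filterS2; first exact: (ae_filter_ringOfSetsType mu2).
    move=> z z2 z1; apply: cvgM; last exact: cvg_cst.
    exact: cvgB.
have rhs : (\int[mu]_x (g x * vn n x)%:E)%E @[n --> \oo] -->
    (\int[mu]_x (g x * v x)%:E)%E.
  have mg : measurable_fun setT g by case/integrableP: gi => /measurable_EFinP.
  have ig : mu.-integrable setT (EFin \o (fun x => C * `|g x|)).
    have := integrableZl measurableT C (integrable_norm gi).
    by apply: eq_integrable.
  have := @dominated_convergence _ _ _ mu setT measurableT
    (fun n x => (g x * vn n x)%:E) (fun x => (g x * v x)%:E) (fun x => (C * `|g x|)%:E).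
  case=> //.
  - by move=> n; apply/measurable_EFinP; apply: measurable_funM; [exact: mg|exact: mvn].
  - by apply/measurable_EFinP; apply: measurable_funM.
  - move: vnv; apply: filterS; first exact: (ae_filter_ringOfSetsType mu).
    move=> x xv _; apply: cvg_EFin; first exact: nearW.
    by apply: cvgM => //; exact: cvg_cst.
  - apply/aeW => x n _; rewrite lee_fin normrM mulrC ler_wpM2r//.
    exact: mollify_bounded (rhoP n) mv vC.
have lhs' : (\int[mu2]_z (G z * dquot (vn n) z)%:E)%E @[n --> \oo] -->
    (\int[mu]_x (g x * v x)%:E)%E.
  by under eq_fun do rewrite (eqn _ (tvn _)).
exact: cvg_unique lhs lhs'.
Qed.

End weak_extension.

(** * Leibniz rule for difference quotients *)

Section dquot_product.
Context (R : realType).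
Notation mu := (@lebesgue_measure R).
Notation mu2 := (mu \x mu)%E.

(** Discrete Leibniz rule with f taken at x and g at y; it is written as a difference to fit
    [square_integrableB]. *)
Lemma dquotM (f g : R -> R) z :
  dquot (fun x => f x * g x) z = f z.1 * dquot g z - (- g z.2) * dquot f z.
Proof. by rewrite /dquot; ring. Qed.

Lemma square_integrable_dquotM (f g : R -> R) (C : R) :
  measurable_fun setT f -> measurable_fun setT g ->
  (forall x, `|f x| <= C) -> (forall x, `|g x| <= C) ->
  square_integrable mu2 (dquot f) -> square_integrable mu2 (dquot g) ->
  square_integrable mu2 (dquot (fun x => f x * g x)).
Proof.
move=> mf mg fC gC fi gi.
have h1 : square_integrable mu2 (fun z => f z.1 * dquot g z).
  by apply: (square_integrable_bounded (C := C)) => //; exact: (measurableT_comp mf).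
have h2 : square_integrable mu2 (fun z => - g z.2 * dquot f z).
  apply: (square_integrable_bounded (C := C)) => //; last by move=> z; rewrite normrN.
  by apply: measurableT_comp => //; exact: (measurableT_comp mg).
rewrite (_ : dquot (fun x => f x * g x) =
  (fun z => f z.1 * dquot g z - - g z.2 * dquot f z)).
  exact: square_integrableB.
by apply/funext => z; rewrite dquotM.
Qed.

End dquot_product.

(** * The equivalence for Borel maps with values on the sphere everywhere *)

Section sphere_valued.
Context (R : realType) (N : nat) (u : 'I_N -> R -> R).
Notation mu := (@lebesgue_measure R).
Notation mu2 := (mu \x mu)%E.
Hypothesis mu_ : forall k, measurable_fun setT (u k).
Hypothesis u1 : forall x, \sum_k u k x ^+ 2 = 1.
Hypothesis du : forall k, square_integrable mu2 (dquot (u k)).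
Implicit Types (h phi : R -> R) (i k : 'I_N).

Definition energy_density (x : R) : \bar R :=
  (\sum_k \int[mu]_y (dquot (u k) (x, y) ^+ 2)%:E)%E.

Definition rot i k (z : R * R) : R :=
  u i z.1 * dquot (u k) z - u k z.1 * dquot (u i) z.

Let E2 (z : R * R) : R := \sum_k dquot (u k) z ^+ 2.

Let u_le1 k x : `|u k x| <= 1.
Proof.
rewrite -(@expr_le1 _ 2)// real_normK ?num_real// -(u1 x) (bigD1 k)//= lerDl.
by apply: sumr_ge0 => l _; exact: sqr_ge0.
Qed.

Let E2_ge0 z : 0 <= E2 z.
Proof. by apply: sumr_ge0 => l _; exact: sqr_ge0. Qed.

Let measurable_E2 : measurable_fun setT E2.
Proof.
apply: measurable_sum => k; apply: measurable_funX; exact: measurable_dquot.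
Qed.

Let integrable_E2 : mu2.-integrable setT (EFin \o E2).
Proof.
have := @integrable_sum _ _ _ mu2 setT measurableT _ (index_enum 'I_N) xpredT
  (fun k z => (dquot (u k) z ^+ 2)%:E) (fun k _ => square_integrable_sqr (du k)).
by apply: eq_integrable => // z _ /=; rewrite /E2 sumEFin.
Qed.

Let integrable_bounded_E2 (f : R * R -> R) (C : R) : measurable_fun setT f ->
  (forall z, `|f z| <= C) -> mu2.-integrable setT (EFin \o (fun z => f z * E2 z)).
Proof.
move=> mf fC.
apply: (@integrable_dominated _ _ _ mu2 _ (fun z => C * E2 z)).
- exact: measurable_funM.
- by move=> z; rewrite normrM (ger0_norm (E2_ge0 z)) ler_wpM2r.
- by have := integrableZl measurableT C integrable_E2; apply: eq_integrable.
Qed.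

Let densityE x : (energy_density x = \int[mu]_y (E2 (x, y))%:E)%E.
Proof.
rewrite /energy_density -ge0_integral_sum//.
- by apply: eq_integral => y _; rewrite /E2 sumEFin.
- move=> k; apply/measurable_EFinP/measurable_funX.
  exact: (measurableT_comp (measurable_dquot (mu_ k))).
- by move=> k y _; rewrite lee_fin sqr_ge0.
Qed.

(** Fubini; the factor h(x) is taken out of the inner integral at those x for which the section of
    [E2] is integrable, which is almost every x. *)
Lemma integral_energy_density h (C : R) : measurable_fun setT h -> (forall x, `|h x| <= C) ->
  (\int[mu]_x ((h x)%:E * energy_density x) = \int[mu2]_z (h z.1 * E2 z)%:E)%E.
Proof.
move=> mh hC.
have ihE : mu2.-integrable setT (EFin \o (fun z => h z.1 * E2 z)).
  by apply: (@integrable_bounded_E2 (fun z => h z.1) C) => //; exact: (measurableT_comp mh).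
rewrite -(integral12_prod_meas1 ihE).
apply: ae_eq_integral => //.
- apply: emeasurable_funM; first exact/measurable_EFinP.
  apply: (eq_measurable_fun (fun x => \int[mu]_y (E2 (x, y))%:E)%E).
    by move=> x _; rewrite densityE.
  apply: (@measurable_fun_fubini_tonelli_F _ _ _ _ _ mu (EFin \o E2)) => //.
  exact/measurable_EFinP.
- exact: measurable_fubini_F ihE.
- have := ae_integrable1 integrable_E2.
  apply: filterS.
  move=> x ix _; rewrite densityE /fubini_F/=.
  by under [RHS]eq_integral do rewrite EFinM; rewrite integralZl.
Qed.

Let density_fin_num : {ae mu, forall x, energy_density x \is a fin_num}.
Proof.
have := ae_integrable1 integrable_E2.
apply: filterS.
by move=> x ix; rewrite densityE; exact: integrable_fin_num ix.
Qed.

Lemma measurable_energy_density : measurable_fun setT energy_density.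
Proof.
apply: (eq_measurable_fun (fun x => \int[mu]_y (E2 (x, y))%:E)%E).
  by move=> x _; rewrite densityE.
apply: (@measurable_fun_fubini_tonelli_F _ _ _ _ _ mu (EFin \o E2)) => //.
exact/measurable_EFinP.
Qed.

Let integral_density_lty : (\int[mu]_x energy_density x < +oo)%E.
Proof.
under eq_integral do rewrite densityE.
have [mE Eoo] := integrableP _ _ _ integrable_E2.
rewrite -(@fubini_tonelli1 _ _ _ _ _ mu mu (EFin \o E2))//.
by move: Eoo; under eq_integral do rewrite /= ger0_norm//.
Qed.

Let density_ge0 x : (0 <= energy_density x)%E.
Proof. by rewrite densityE integral_ge0// => y _; rewrite lee_fin. Qed.

Let integrable_fine_density : mu.-integrable setT (EFin \o (fun x => fine (energy_density x))).
Proof.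
have md := measurable_energy_density; apply/integrableP; split.
  by apply/measurable_EFinP; apply: measurableT_comp.
apply: le_lt_trans integral_density_lty.
apply: ge0_le_integral => //.
- by apply: measurableT_comp => //; apply/measurable_EFinP; apply: measurableT_comp.
- move=> x _ /=; rewrite ger0_norm ?fine_ge0//.
  by case: (energy_density x) (density_ge0 x) => [r| |]//= _; rewrite leey.
Qed.

(** The extension of weak equations takes a real-valued [g]. The density is finite almost
    everywhere, so replacing it by its [fine] part changes no integral. *)
Lemma integral_fine_density h : measurable_fun setT h ->
  (\int[mu]_x (fine (energy_density x) * h x)%:E = \int[mu]_x ((h x)%:E * energy_density x))%E.
Proof.
move=> mh; have md := measurable_energy_density; apply: ae_eq_integral => //.
- by apply/measurable_EFinP; apply: measurable_funM => //; exact: measurableT_comp.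
- by apply: emeasurable_funM => //; exact/measurable_EFinP.
- move: density_fin_num; apply: filterS; first exact: (ae_filter_ringOfSetsType mu).
  by move=> x fx _; rewrite muleC EFinM fineK.
Qed.

Lemma square_integrable_rot i k : square_integrable mu2 (rot i k).
Proof.
apply: square_integrableB; (apply: (square_integrable_bounded (C := 1)) => //;
  exact: (measurableT_comp (mu_ _))).
Qed.

Let product_square_integrable k phi : test_function phi ->
  square_integrable mu2 (dquot (fun x => u k x * phi x)).
Proof.
move=> tphi; have [C phiC] := test_function_bounded tphi.
apply: (@square_integrable_dquotM _ _ _ (Num.max 1 C)) => //.
- by apply: smoothn_measurable; exact: test_function_smoothn.
- by move=> x; rewrite le_max u_le1.
- by move=> x; rewrite le_max phiC orbT.
- exact: dquot_test_function.
Qed.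

Let test_product k phi (G : R * R -> R) (g : R -> R) : test_function phi ->
  square_integrable mu2 G -> mu.-integrable setT (EFin \o g) ->
  (forall phi, test_function phi ->
    (\int[mu2]_z (G z * dquot phi z)%:E = \int[mu]_x (g x * phi x)%:E)%E) ->
  (\int[mu2]_z (G z * dquot (fun x => (u k x * phi x)%R) z)%:E =
   \int[mu]_x (g x * (u k x * phi x))%:E)%E.
Proof.
move=> tphi Gi gi eqn.
have [A phiA] := supported_test_function tphi.
have [C phiC] := test_function_bounded tphi.
have mphi : measurable_fun setT phi.
  by apply: smoothn_measurable; exact: test_function_smoothn.
apply: (@weak_equation_extension R G g (fun x => u k x * phi x) A C) => //.
- exact: measurable_funM.
- by move=> x; rewrite normrM -[leRHS]mul1r ler_pM.
- by move=> x /phiA ->; rewrite mulr0.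
- exact: product_square_integrable.
Qed.

Lemma rot_free_of_harmonic :
  (forall i phi, test_function phi ->
    (\int[mu2]_z (dquot (u i) z * dquot phi z)%:E =
     \int[mu]_x ((u i x * phi x)%:E * energy_density x))%E) ->
  forall i k phi, test_function phi ->
    (\int[mu2]_z (rot i k z * dquot phi z)%:E = 0)%E.
Proof.
move=> eqn i k phi tphi; have md := measurable_energy_density.
have mphi : measurable_fun setT phi.
  by apply: smoothn_measurable; exact: test_function_smoothn.
pose g i x := u i x * fine (energy_density x).
have gi i' : mu.-integrable setT (EFin \o g i').
  apply: (@integrable_dominated _ _ _ mu (g i') (fun x => fine (energy_density x))) => //.
  - by apply: measurable_funM; [exact: mu_|exact: measurableT_comp].
  - move=> x; rewrite normrM (ger0_norm (fine_ge0 _))//.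
    by rewrite ler_piMl ?fine_ge0.
have key i' k' : (\int[mu2]_z (dquot (u i') z * dquot (fun x => (u k' x * phi x)%R) z)%:E =
    \int[mu]_x (g i' x * (u k' x * phi x))%:E)%E.
  apply: test_product => // psi tpsi.
  have mpsi : measurable_fun setT psi.
    by apply: smoothn_measurable; exact: test_function_smoothn.
  rewrite eqn// -integral_fine_density; last exact: measurable_funM.
  by apply: eq_integral => x _; rewrite /g; congr EFin; ring.
have iprod i' k' : mu2.-integrable setT
    (EFin \o (fun z => dquot (u i') z * dquot (fun x => (u k' x * phi x)%R) z)).
  apply: square_integrableM => //.
  exact: product_square_integrable.
transitivity (\int[mu2]_z ((dquot (u k) z * dquot (fun x => (u i x * phi x)%R) z)%:E -
    (dquot (u i) z * dquot (fun x => (u k x * phi x)%R) z)%:E))%E.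
  apply: eq_integral => z _; rewrite -EFinB /rot /dquot; congr EFin.
  ring.
rewrite (integralB measurableT (iprod k i) (iprod i k)) !key.
(* Both right-hand sides have the integrand u^i u^k phi |D u|^2, symmetric in i and k. Their
   cancellation needs a finite value, which the integrable left-hand pairing supplies. *)
rewrite (_ : (fun x => (g k x * (u i x * phi x))%:E) = (fun x => (g i x * (u k x * phi x))%:E)).
  rewrite subee// -key; exact: integrable_fin_num (iprod i k).
by apply/funext => x; rewrite /g; congr EFin; ring.
Qed.

Lemma harmonic_of_rot_free :
  (forall i k phi, test_function phi ->
    (\int[mu2]_z (rot i k z * dquot phi z)%:E = 0)%E) ->
  forall i phi, test_function phi ->
    (\int[mu2]_z (dquot (u i) z * dquot phi z)%:E =
     \int[mu]_x ((u i x * phi x)%:E * energy_density x))%E.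
Proof.
move=> eqn i phi tphi.
have mphi : measurable_fun setT phi.
  by apply: smoothn_measurable; exact: test_function_smoothn.
have [C phiC] := test_function_bounded tphi.
have key k : (\int[mu2]_z (rot i k z * dquot (fun x => (u k x * phi x)%R) z)%:E = 0)%E.
  rewrite (@test_product k phi (rot i k) (cst 0))//.
  - by under eq_integral do rewrite /= mul0r; rewrite integral0.
  - exact: square_integrable_rot.
  - exact: integrable0.
  - move=> psi tpsi; rewrite eqn//.
    by under eq_integral do rewrite /= mul0r; rewrite integral0.
have iprod k : mu2.-integrable setT
    (EFin \o (fun z => rot i k z * dquot (fun x => (u k x * phi x)%R) z)).
  apply: square_integrableM; first exact: square_integrable_rot.
  exact: product_square_integrable.
pose h x := u i x * phi x.
have mh : measurable_fun setT h by exact: measurable_funM.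
have hC x : `|h x| <= C by rewrite normrM -[leRHS]mul1r ler_pM.
rewrite (integral_energy_density mh hC).
have iphi : mu2.-integrable setT (EFin \o (fun z => dquot (u i) z * dquot phi z)).
  by apply: square_integrableM => //; exact: dquot_test_function.
have ih1 : mu2.-integrable setT (EFin \o (fun z => h z.1 * E2 z)).
  by apply: (@integrable_bounded_E2 (fun z => h z.1) C) => //; exact: (measurableT_comp mh).
have ih2 : mu2.-integrable setT (EFin \o (fun z => h z.2 * E2 z)).
  by apply: (@integrable_bounded_E2 (fun z => h z.2) C) => //; exact: (measurableT_comp mh).
have ptw z : \sum_k rot i k z * dquot (fun x => (u k x * phi x)%R) z =
    2^-1 * (h z.1 * E2 z) + 2^-1 * (h z.2 * E2 z) - dquot (u i) z * dquot phi z.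
  case: z => x y; rewrite /E2 /rot /h /dquot/=.
  move: `|x - y|^-1 => w.
  (* Because |u(x)| = |u(y)| = 1, both sides of the identity are affine in this inner product. *)
  pose S := \sum_k u k x * u k y.
  have -> : \sum_k ((u k x - u k y) * w) ^+ 2 = w ^+ 2 * (2 - 2 * S).
    transitivity (\sum_k w ^+ 2 * (u k x ^+ 2 + u k y ^+ 2 - 2 * (u k x * u k y))).
      by apply: eq_bigr => k _; ring.
    rewrite -mulr_sumr sumrB big_split/= !u1 -mulr_sumr; congr (_ * _); rewrite /S; ring.
  transitivity (\sum_k w ^+ 2 * (u i y * phi x * u k x ^+ 2 +
      u i x * phi y * u k y ^+ 2 - (u i y * phi y + u i x * phi x) * (u k x * u k y))).
    by apply: eq_bigr => k _; ring.
  rewrite -mulr_sumr sumrB big_split/= -!mulr_sumr !u1 -/S.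
  by field.
have swapE : (\int[mu2]_z (h z.2 * E2 z)%:E = \int[mu2]_z (h z.1 * E2 z)%:E)%E.
  have := @integral_swap R (fun z => (h z.1 * E2 z)%:E).
  move=> <-; last by apply/measurable_EFinP; apply: measurable_funM => //; exact: (measurableT_comp mh).
  apply: eq_integral => -[x y] _ /=; congr ((_ * _)%:E).
  by apply: eq_bigr => k _; rewrite /dquot/= distrC -sqrrN -mulNr opprB.
have : (\int[mu2]_z ((2^-1)%:E * (h z.1 * E2 z)%:E + (2^-1)%:E * (h z.2 * E2 z)%:E -
    (dquot (u i) z * dquot phi z)%:E) = 0)%E.
  transitivity (\int[mu2]_z (\sum_k (rot i k z * dquot (fun x => (u k x * phi x)%R) z)%:E))%E.
    by apply: eq_integral => z _; rewrite sumEFin ptw -!EFinM -!EFinD.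
  by rewrite integral_sum//; apply: big1 => k _; exact: key.
have i1 := integrableZl measurableT 2^-1 ih1.
have i2 := integrableZl measurableT 2^-1 ih2.
rewrite integralB//; last exact: integrableD.
rewrite integralD// !integralZl// swapE.
have fA := integrable_fin_num measurableT ih1.
have fB := integrable_fin_num measurableT iphi.
rewrite -(fineK fA) -(fineK fB) -!EFinM -!EFinD => -[] e.
by congr EFin; move: e; set a := fine _; set b := fine _; lra.
Qed.

End sphere_valued.

(** * Passing from Lebesgue to Borel measurability *)

Section lebesgue_borel.
Context (R : realType).
Notation mu := (@lebesgue_measure R).
Notation mu2 := (mu \x mu)%E.

(** The identity is named to give it distinct sigma-algebras on its source and target; it is then a
    measure-preserving map like any other. *)
Definition borel_of_lebesgue (x : lebR R) : measurableTypeR R := x.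

Lemma measurable_borel_of_lebesgue : measurable_fun setT borel_of_lebesgue.
Proof. by move=> _ A mA; rewrite setTI; exact: sub_caratheodory. Qed.

Lemma integral_lebesgue_borel (f : R -> \bar R) : measurable_fun setT f ->
  (\int[leb R]_x f x = \int[mu]_x f x)%E.
Proof.
move=> mf.
exact: (integral_measure_preserving (m2 := mu) measurable_borel_of_lebesgue _ mf).
Qed.

Definition borel2_of_lebesgue2 (z : lebR R * lebR R) :
  measurableTypeR R * measurableTypeR R := z.

Lemma measurable_borel2_of_lebesgue2 : measurable_fun setT borel2_of_lebesgue2.
Proof.
apply/measurable_fun_pairP; split.
  exact: (measurableT_comp measurable_borel_of_lebesgue (@measurable_fst _ _ _ _)).
exact: (measurableT_comp measurable_borel_of_lebesgue (@measurable_snd _ _ _ _)).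
Qed.

Lemma integral_lebesgue2_borel2 (f : R * R -> \bar R) : measurable_fun setT f ->
  (\int[leb2 R]_z f z = \int[mu2]_z f z)%E.
Proof.
move=> mf.
apply: (integral_measure_preserving (m2 := mu2) measurable_borel2_of_lebesgue2 _ mf).
apply: product_measure_preserving; first exact: measurable_borel2_of_lebesgue2.
move=> A B mA mB; rewrite product_measure1E//; exact: sub_caratheodory.
Qed.

Lemma lebesgue_measurable_decomp (A : set R) : measurable (A : set (lebR R)) ->
  exists2 X : set R, measurable X & exists2 Y, mu.-negligible Y & X `|` Y = A.
Proof.
move=> mA.
have : completed_algebra_gen mu A.
  by rewrite -g_sigma_completed_algebra_genE completed_caratheodory_measurable.
by move=> [X mX [Y nY XYA]]; exists X => //; exists Y.
Qed.

Lemma lebesgue_negligible_borel (A : set R) :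
  (leb R).-negligible (A : set (lebR R)) -> mu.-negligible A.
Proof.
move=> [B [mB B0 AB]].
have [X mX [Y nY XYB]] := lebesgue_measurable_decomp mB.
have nX : mu.-negligible X.
  exists X; split => //; apply/eqP; rewrite -measure_le0.
  by rewrite -B0; apply: le_outer_measure; rewrite -XYB; left.
apply: (@negligibleS _ _ _ mu B A AB); rewrite -XYB; exact: negligibleU.
Qed.

(** For rational q, each set where f_k > q differs from a Borel set by a null set. These are
    countably many, so one Borel null set [M] contains all exceptional points; off [M] the rational
    superlevel sets are Borel, and they generate the others. *)
Lemma borel_representative (I : finType) (f : I -> R -> R) :
  (forall k, measurable_fun [set: lebR R] (f k)) ->
  exists M : set R, [/\ measurable M, mu M = 0%E &
    forall k, measurable_fun (~` M) (f k)].
Proof.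
move=> mf.
have XP (kq : I * rat) : exists X : set R, measurable X /\
    {ae mu, forall x, X x <-> ratr kq.2 < f kq.1 x}.
  have mA : measurable (f kq.1 @^-1` `]ratr kq.2, +oo[%classic : set (lebR R)).
    by rewrite -[_ @^-1` _]setTI; exact: mf.
  have [X mX [Y nY XYE]] := lebesgue_measurable_decomp mA.
  exists X; split => //; apply: negligibleS nY => x /= nx.
  have E z : (X `|` Y) z <-> ratr kq.2 < f kq.1 z.
    by rewrite XYE /= in_itv/= andbT.
  apply: contrapT => Yx; apply: nx; rewrite -E.
  by split; [left|case].
pose X kq := projT1 (cid (XP kq)).
have mX kq : measurable (X kq) by case: (projT2 (cid (XP kq))).
have aeX kq : {ae mu, forall x, X kq x <-> ratr kq.2 < f kq.1 x}.
  by case: (projT2 (cid (XP kq))).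
(* Countable intersections of almost sure events are indexed by [nat], hence the enumeration of the
   pairs; codes of no pair impose no condition. *)
have : {ae mu, forall x (n : nat) kq, unpickle n = Some kq ->
    (X kq x <-> ratr kq.2 < f kq.1 x)}.
  apply/ae_foralln => n.
  case E : (unpickle n) => [kq|]; last by apply/aeW.
  move: (aeX kq); apply: filterS; first exact: (ae_filter_ringOfSetsType mu).
  by move=> x ? _ [<-].
move=> [M [mM M0 XM]]; exists M; split => // k.
have XE x q : (~` M) x -> X (k, q) x <-> ratr q < f k x.
  move=> Mx; have /contrapT := contra_not (XM x) Mx.
  by move=> /(_ (pickle (k, q)) (k, q)); apply; rewrite pickleK.
move=> mC; apply: (measurability _ (RGenOInfty.measurableE R)) => //.
move=> _ [_ [y ->] <-].
rewrite (_ : _ `&` _ = \bigcup_q (if y < ratr q then ~` M `&` X (k, q) else set0)).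
  by apply: bigcupT_measurable_rat => q; case: ifP => // _; exact: measurableI.
apply/seteqP; split=> x /=.
  move=> [Mx]; rewrite in_itv/= andbT => /rat_in_itvoo[q]; rewrite in_itv/= => /andP[yq qf].
  by exists q => //; rewrite yq; split => //; apply/XE.
move=> [q _]; case: ifPn => // yq [Mx Xx]; split => //.
by rewrite in_itv/= andbT (lt_trans yq)//; apply/XE.
Qed.

End lebesgue_borel.

(** * Replacing [u] by a Borel representative in every integral *)

Section transfer.
Context (R : realType) (N : nat) (u : R -> 'rV[R]_N).
Notation mu := (@lebesgue_measure R).
Notation mu2 := (mu \x mu)%E.
Hypothesis hu : Hdot12 u.
Variables (M : set R) (w : 'I_N -> R -> R).
Hypotheses (mM : measurable M) (M0 : mu M = 0%E).
Hypothesis mw : forall k, measurable_fun setT (w k).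
Hypothesis w1 : forall x, \sum_k w k x ^+ 2 = 1.
Hypothesis wE : forall k x, ~ M x -> w k x = ucomp u k x.

Let mu_ k : measurable_fun [set: lebR R] (ucomp u k). Proof. by case: hu. Qed.

Let mM' : measurable (M : set (lebR R)). Proof. exact: sub_caratheodory. Qed.

Let M0' : leb R M = 0%E. Proof. exact: M0. Qed.

Lemma integral_modification (F G : R -> \bar R) :
  measurable_fun [set: lebR R] F -> measurable_fun setT G ->
  (forall x, ~ M x -> F x = G x) ->
  (\int[leb R]_x F x = \int[mu]_x G x)%E.
Proof.
move=> mF mG FG; rewrite -integral_lebesgue_borel//.
apply: ae_eq_integral => //.
  exact: (measurableT_comp mG (@measurable_borel_of_lebesgue R)).
exists M; split => // x /=; apply: contra_notP => Mx _; exact: FG.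
Qed.

Lemma integral2_modification (F G : R * R -> R) :
  measurable_fun [set: lebR R * lebR R] F -> measurable_fun setT G ->
  (forall x y, ~ M x -> ~ M y -> F (x, y) = G (x, y)) ->
  (\int[leb2 R]_z (F z)%:E = \int[mu2]_z (G z)%:E)%E.
Proof.
move=> mF mG FG; rewrite -integral_lebesgue2_borel2; last exact/measurable_EFinP.
apply: ae_eq_integral => //.
- exact/measurable_EFinP.
- apply/measurable_EFinP.
  exact: (measurableT_comp mG (@measurable_borel2_of_lebesgue2 R)).
exists ((M `*` setT) `|` (setT `*` M)); split.
- by apply: measurableU; apply: measurableX.
- apply: null_set_setU; [exact: measurableX|exact: measurableX|..].
    by apply: etrans (product_measure1E _ _ _ _) _ => //; rewrite [X in (X * _)%E]M0' mul0e.
  by apply: etrans (product_measure1E _ _ _ _) _ => //; rewrite [X in (_ * X)%E]M0' mule0.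
- move=> [x y] /= Fxy.
  have [Mx|Mx] := pselect (M x); first by left.
  have [My|My] := pselect (M y); first by right.
  by exfalso; apply: Fxy => _; rewrite FG.
Qed.

(** The two square roots and the weight combine into |x - y|^-2, so the form defining the
    half-Laplacian is the plain L^2 pairing of [dquot f] and [dquot g]. *)
Lemma d12E (f g : R -> R) x y :
  d12 f x y * d12 g x y / `|x - y| = dquot f (x, y) * dquot g (x, y).
Proof.
rewrite /d12 /dquot/=.
have -> : `|x - y|^-1 = (Num.sqrt `|x - y|)^-1 ^+ 2.
  by rewrite exprVn sqr_sqrtr.
by ring.
Qed.

Lemma OmegaE i k (g : R -> R) x y :
  Omega u i k x y * d12 g x y / `|x - y| =
  (ucomp u i x * dquot (ucomp u k) (x, y) - ucomp u k x * dquot (ucomp u i) (x, y)) *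
  dquot g (x, y).
Proof.
transitivity (ucomp u i x * (d12 (ucomp u k) x y * d12 g x y / `|x - y|) -
    ucomp u k x * (d12 (ucomp u i) x y * d12 g x y / `|x - y|)).
  by rewrite /Omega; ring.
by rewrite !d12E; ring.
Qed.

Lemma measurable_dist_inv_lebesgue :
  measurable_fun [set: lebR R * lebR R] (fun z => `|(z.1 : R) - z.2|^-1).
Proof.
exact: (measurableT_comp (@measurable_dist_inv R) (@measurable_borel2_of_lebesgue2 R)).
Qed.

Lemma measurable_dquot_lebesgue (f : R -> R) : measurable_fun [set: lebR R] f ->
  measurable_fun [set: lebR R * lebR R] (dquot f).
Proof.
move=> mf; apply: measurable_funM; last exact: measurable_dist_inv_lebesgue.
by apply: measurable_funB; apply: (measurableT_comp mf).
Qed.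

Lemma dquot_modification k x y : ~ M x -> ~ M y ->
  dquot (ucomp u k) (x, y) = dquot (w k) (x, y).
Proof. by move=> Mx My; rewrite /dquot/= !wE. Qed.

Lemma enorm_dquotE x y :
  enorm (u x - u y) ^+ 2 / `|x - y| ^+ 2 = \sum_k dquot (ucomp u k) (x, y) ^+ 2.
Proof.
rewrite /enorm sqr_sqrtr; last by apply: sumr_ge0 => k _; exact: sqr_ge0.
by rewrite mulr_suml; apply: eq_bigr => k _; rewrite /dquot/= !mxE expr_div_n.
Qed.

Lemma square_integrable_modification k : square_integrable mu2 (dquot (w k)).
Proof.
split; first exact: measurable_dquot.
rewrite -(@integral2_modification (fun z => dquot (ucomp u k) z ^+ 2)).
- case: hu => _ uoo _; apply: le_lt_trans uoo.
  have -> : (\int[leb2 R]_z (enorm (u z.1 - u z.2) ^+ 2 / `|(z.1 : R) - z.2| ^+ 2)%:E =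
      \int[leb2 R]_z (\sum_l dquot (ucomp u l) z ^+ 2)%:E)%E.
    by apply: eq_integral => -[x y] _; rewrite enorm_dquotE.
  apply: ge0_le_integral => //.
  - by move=> z _; rewrite lee_fin sqr_ge0.
  - by apply/measurable_EFinP; apply: measurable_funX; exact: measurable_dquot_lebesgue.
  - apply/measurable_EFinP; apply: measurable_sum => l; apply: measurable_funX.
    exact: measurable_dquot_lebesgue.
  - move=> z _; rewrite lee_fin (bigD1 k)//= lerDl.
    by apply: sumr_ge0 => l _; exact: sqr_ge0.
- by apply: measurable_funX; exact: measurable_dquot_lebesgue.
- by apply: measurable_funX; exact: measurable_dquot.
- by move=> x y Mx My; rewrite dquot_modification.
Qed.

Lemma pair12_modification i (phi : R -> R) : measurable_fun setT phi ->
  pair12 (d12 (ucomp u i)) (d12 phi) =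
  (\int[mu2]_z (dquot (w i) z * dquot phi z)%:E)%E.
Proof.
move=> mphi; rewrite /pair12.
rewrite -(@integral2_modification (fun z => dquot (ucomp u i) z * dquot phi z)).
- by apply: eq_integral => -[x y] _; rewrite d12E.
- apply: measurable_funM; apply: measurable_dquot_lebesgue => //.
  exact: (measurableT_comp mphi (@measurable_borel_of_lebesgue R)).
- by apply: measurable_funM; exact: measurable_dquot.
- by move=> x y Mx My; rewrite dquot_modification.
Qed.

Lemma pair12_Omega_modification i k (phi : R -> R) : measurable_fun setT phi ->
  pair12 (Omega u i k) (d12 phi) =
  (\int[mu2]_z (rot w i k z * dquot phi z)%:E)%E.
Proof.
move=> mphi; rewrite /pair12.
rewrite -(@integral2_modification (fun z => (ucomp u i z.1 * dquot (ucomp u k) z -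
   ucomp u k z.1 * dquot (ucomp u i) z) * dquot phi z)).
- by apply: eq_integral => -[x y] _; rewrite OmegaE.
- apply: measurable_funM; last first.
    apply: measurable_dquot_lebesgue.
    exact: (measurableT_comp mphi (@measurable_borel_of_lebesgue R)).
  apply: measurable_funB; (apply: measurable_funM; last exact: measurable_dquot_lebesgue);
    exact: (measurableT_comp (mu_ _)).
- apply: measurable_funM; last exact: measurable_dquot.
  apply: measurable_funB; (apply: measurable_funM; last exact: measurable_dquot);
    exact: (measurableT_comp (mw _)).
- by move=> x y Mx My; rewrite /rot !dquot_modification// !wE.
Qed.

Lemma sq_d12E x : sq_d12 u x =
  (\sum_k \int[leb R]_y (dquot (ucomp u k) (x, y) ^+ 2)%:E)%E.
Proof.
apply: eq_bigr => k _; apply: eq_integral => y _.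
by rewrite real_normK ?num_real// expr2 d12E -expr2.
Qed.

Lemma sq_d12_modification x : ~ M x -> sq_d12 u x = energy_density w x.
Proof.
move=> Mx; rewrite sq_d12E; apply: eq_bigr => k _.
apply: integral_modification.
- apply/measurable_EFinP; apply: measurable_funX.
  exact: (measurableT_comp (measurable_dquot_lebesgue (mu_ k))).
- apply/measurable_EFinP; apply: measurable_funX.
  exact: (measurableT_comp (measurable_dquot (mw k))).
- by move=> y My; rewrite dquot_modification.
Qed.

Lemma measurable_sq_d12 : measurable_fun [set: lebR R] (sq_d12 u).
Proof.
rewrite (_ : sq_d12 u =
  (fun x => \sum_k \int[leb R]_y (dquot (ucomp u k) (x, y) ^+ 2)%:E)%E); last first.
  by apply/funext => x; rewrite sq_d12E.
apply: emeasurable_sum => k.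
have m2 : measurable_fun setT (EFin \o (fun z : lebR R * lebR R => dquot (ucomp u k) z ^+ 2)).
  by apply/measurable_EFinP; apply: measurable_funX; exact: measurable_dquot_lebesgue.
apply: (measurable_fun_fubini_tonelli_F (m2 := leb R) _ m2).
by move=> z; rewrite lee_fin sqr_ge0.
Qed.

Lemma integral_sq_d12_modification i (phi : R -> R) : measurable_fun setT phi ->
  (\int[leb R]_x ((ucomp u i x)%:E * sq_d12 u x * (phi x)%:E) =
   \int[mu]_x ((w i x * phi x)%:E * energy_density w x))%E.
Proof.
move=> mphi; apply: integral_modification.
- apply: emeasurable_funM.
    apply: emeasurable_funM; last exact: measurable_sq_d12.
    exact/measurable_EFinP.
  apply/measurable_EFinP.
  exact: (measurableT_comp mphi (@measurable_borel_of_lebesgue R)).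
- apply: emeasurable_funM; first exact/measurable_EFinP/measurable_funM.
  exact: measurable_energy_density.
- by move=> x Mx; rewrite sq_d12_modification// -wE// EFinM muleAC.
Qed.

End transfer.

(** * The equivalence for maps with values on the sphere almost everywhere *)

Theorem lemma3p1 (R : realType) (N : nat) (u : R -> 'rV[R]_N) (hu : Hdot12 u) :
  (forall i : 'I_N, half_harmonic_eq u i) <->
  (forall i k : 'I_N, div12_eq0 (Omega u i k)).
Proof.
(* There are no indices when N = 0; in the remaining case [ord0] is available to choose a point of
   the sphere. *)
case: N u hu => [|N] u hu; first by split=> _ [].
have [mu_ uoo u1] := hu.
have [M1 [mM1 M10 mf]] := borel_representative mu_.
have [M2 [mM2 M20 sM2]] := lebesgue_negligible_borel u1.
(* Off [M1] the components are Borel measurable, and [M2] contains every point where |u| differs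
   from 1. *)
pose M := M1 `|` M2.
have mM : measurable M by exact: measurableU.
have M0 : lebesgue_measure M = 0%E by exact: null_set_setU.
(* Equal to [u] off [M] and to the first basis vector on [M], hence Borel and of norm 1 at every
   point. *)
pose w (k : 'I_N.+1) : R -> R := fun x =>
  (ucomp u k \_ (~` M)) x + (k == ord0)%:R * \1_M x.
have wE k x : ~ M x -> w k x = ucomp u k x.
  by move=> Mx; rewrite /w indicE memNset// mulr0 addr0 patchT// inE.
have wME k x : M x -> w k x = (k == ord0)%:R.
  move=> Mx; rewrite /w indicE mem_set// mulr1 patchN ?add0r//.
  by apply/negP; rewrite inE => /(_ Mx).
have mw k : measurable_fun setT (w k).
  apply: measurable_funD; last first.
    by apply: measurable_funM => //; exact: measurable_indic.
  apply/(measurable_restrictT _ _).1; first exact: measurableC.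
  apply: measurable_funS (mf k); first exact: measurableC.
  by apply: subsetC; exact: subsetUl.
have w1 x : \sum_k w k x ^+ 2 = 1.
  have [Mx|Mx] := pselect (M x).
    rewrite (bigD1 ord0)//= big1 ?addr0; first by rewrite wME// expr1n.
    by move=> k k0; rewrite wME// (negbTE k0) expr0n.
  have : enorm (u x) = 1 by apply: contrapT => h; apply: Mx; right; exact: sM2.
  move=> /(congr1 (fun r => r ^+ 2)); rewrite expr1n /enorm sqr_sqrtr.
    by move=> <-; apply: eq_bigr => k _; rewrite wE.
  by apply: sumr_ge0 => k _; exact: sqr_ge0.
have dw := square_integrable_modification hu mM M0 mw wE.
have mphi (phi : R -> R) : test_function phi -> measurable_fun setT phi.
  by move=> tphi; apply: smoothn_measurable; exact: test_function_smoothn.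
split=> eqn.
  move=> i k phi tphi.
  rewrite (pair12_Omega_modification hu mM M0 mw wE)//; last exact: mphi.
  apply: (rot_free_of_harmonic mw w1 dw) => // j psi tpsi.
  rewrite -(pair12_modification hu mM M0 mw wE); last exact: mphi.
  rewrite -(integral_sq_d12_modification hu mM M0 mw wE); last exact: mphi.
  exact: eqn.
move=> i phi tphi.
rewrite (pair12_modification hu mM M0 mw wE); last exact: mphi.
rewrite (integral_sq_d12_modification hu mM M0 mw wE); last exact: mphi.
apply: (harmonic_of_rot_free mw w1 dw) => // j k psi tpsi.
rewrite -(pair12_Omega_modification hu mM M0 mw wE)//; last exact: mphi.
exact: eqn.
Qed.
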